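(* Let $Y=(Y^1,\ldots,Y^d)$ be the multivariate fractional Ornstein--Uhlenbeck process with parameters $\alpha_i,\nu_i>0$, $H_i\in(0,1)\setminus\{1/2\}$, $\rho_{ij},\eta_{ij}$. Let $i,j\in\{1,\dots,d\}$, $i\neq j$, $H_{ij}=H_i+H_j$, and $N\in\mathbb{N}$. Fix $t\in\mathbb{R}$. If $H_{ij}\neq1$, then as $s\to\infty$ $$\mathrm{Cov}(Y^i_t,Y^j_{t+s})=\frac{\nu_i\nu_j(\rho_{ij}+\eta_{ji})}{2(\alpha_i+\alpha_j)}\sum_{n=0}^N\Big(\frac{(-1)^n}{\alpha_j^{n+1}}+\frac1{\alpha_i^{n+1}}\Big)\Big(\prod_{k=0}^{n+1}(H_{ij}-k)\Big)s^{H_{ij}-2-n}+O(s^{H_{ij}-N-3}).$$ If $H_{ij}=1$, then as $s\to\infty$ $$\mathrm{Cov}(Y^i_t,Y^j_{t+s})=-\frac{\nu_i\nu_j\eta_{ji}}{2\alpha_i\alpha_j}\frac1s-\frac{\nu_i\nu_j\eta_{ji}}{2(\alpha_i+\alpha_j)}\sum_{n=1}^N\Big(\frac{(-1)^n}{\alpha_j^{n+1}}+\frac1{\alpha_i^{n+1}}\Big)\Big(\prod_{k=0}^{n-1}(-k-1)\Big)s^{-1-n}+O(s^{-N-2}).$$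
   Context: Let $d\in\mathbb{N}$, $H_1,\dots,H_d\in(0,1)\setminus\{1/2\}$, $H_{ij}=H_i+H_j$. A $d$-variate fractional Brownian motion is a centered Gaussian process $(B^{H_1}_t,\dots,B^{H_d}_t)_{t\in\mathbb{R}}$ in $\mathbb{R}^d$ (taken with continuous paths) such that each $B^{H_i}$ is a fractional Brownian motion with Hurst index $H_i$; for every $\lambda>0$, $(B^{H_1}_{\lambda t},\dots,B^{H_d}_{\lambda t})_{t}$ and $(\lambda^{H_1}B^{H_1}_t,\dots,\lambda^{H_d}B^{H_d}_t)_{t}$ have the same finite-dimensional distributions; and it has stationary increments. We normalize $\mathrm{Var}(B^{H_i}_1)=1$. For $i\ne j$ there are then (known fact) $\rho_{ij}=\rho_{ji}\in[-1,1]$, $\eta_{ij}=-\eta_{ji}\in\mathbb{R}$ with $\rho_{ij}=\mathrm{Corr}(B_1^{H_i},B_1^{H_j})$ and, for $t,s\in\mathbb{R}$: if $H_{ij}\ne1$, $$\mathrm{Cov}(B^{H_i}_t,B^{H_j}_s)=\tfrac12\big((\rho_{ij}+\mathrm{sign}(t)\eta_{ij})|t|^{H_{ij}}+(\rho_{ij}-\mathrm{sign}(s)\eta_{ij})|s|^{H_{ij}}-(\rho_{ij}-\mathrm{sign}(s-t)\eta_{ij})|s-t|^{H_{ij}}\big);$$ if $H_{ij}=1$, $$\mathrm{Cov}(B^{H_i}_t,B^{H_j}_s)=\tfrac12\big(\rho_{ij}(|s|+|t|-|s-t|)+\eta_{ij}(s\log|s|-t\log|t|-(s-t)\log|s-t|)\big),$$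 where $\mathrm{sign}(x)=1$ for $x\ge0$, $-1$ for $x<0$, and $0\log0=0$. For $\alpha_i,\nu_i>0$, the multivariate fractional Ornstein--Uhlenbeck process $Y=(Y^1_t,\dots,Y^d_t)_{t\in\mathbb{R}}$ is $$Y^i_t=\nu_i\int_{-\infty}^te^{-\alpha_i(t-u)}dB^{H_i}_u,\quad i=1,\dots,d,$$ with pathwise Riemann--Stieltjes integrals, i.e. $Y^i_t=\nu_i\big(B^{H_i}_t-\alpha_i\int_{-\infty}^tB^{H_i}_ue^{-\alpha_i(t-u)}du\big)$ almost surely. *)

(* Defs.v *)
From HB Require Import structures.
From mathcomp Require Import all_boot all_order all_algebra.
From mathcomp Require Import all_classical all_reals all_analysis.
Set Implicit Arguments.
Unset Strict Implicit.
Unset Printing Implicit Defensive.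
Import Order.TTheory GRing.Theory Num.Theory.
Import numFieldNormedType.Exports.
Local Open Scope classical_set_scope.
Local Open Scope ring_scope.

(* A family of real random variables is indexed by an arbitrary type [I]; an
   R^d-valued process (X^1_t, .., X^d_t)_t is the family indexed by the pairs
   (i, t). *)

Definition gaussian_rv (disp : measure_display) (T : measurableType disp)
    (R : realType) (P : probability T R) (X : T -> R) : Prop :=
  exists m sigma : R, 0 <= sigma /\
    forall A : set R, measurable A ->
      (* [normal_prob m 0] is not the point mass at m *)
      P (X @^-1` A) = if sigma == 0 then \d_m A else normal_prob m sigma A.

Definition gaussian_process (disp : measure_display) (T : measurableType disp)
    (R : realType) (P : probability T R) (I : Type) (X : I -> T -> R) : Prop :=
  forall (n : nat) (tau : 'I_n -> I) (c : 'I_n -> R),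
    gaussian_rv P (fun w => \sum_(k < n) c k * X (tau k) w).

Definition centered (disp : measure_display) (T : measurableType disp)
    (R : realType) (P : probability T R) (I : Type) (X : I -> T -> R) : Prop :=
  forall a : I, expectation P (X a) = 0%E.

Definition same_fdd (disp : measure_display) (T : measurableType disp)
    (R : realType) (P : probability T R) (I : Type) (X Y : I -> T -> R) : Prop :=
  forall (n : nat) (tau : 'I_n -> I) (A : set (n.-tuple R)), measurable A ->
    P [set w | A [tuple X (tau k) w | k < n]] =
    P [set w | A [tuple Y (tau k) w | k < n]].

Definition is_fBm (disp : measure_display) (T : measurableType disp)
    (R : realType) (P : probability T R) (H : R) (X : R -> T -> R) : Prop :=
  [/\ gaussian_process P X, centered P X &
      exists2 sigma : R, 0 < sigma & forall t s : R,
        covariance P (X t) (X s) =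
        (sigma ^+ 2 / 2 *
          (`|t| `^ (2 * H) + `|s| `^ (2 * H) - `|t - s| `^ (2 * H)))%:E].

Record is_mfBm (disp : measure_display) (T : measurableType disp)
    (R : realType) (P : probability T R) (d : nat) (H : 'I_d -> R)
    (B : 'I_d -> R -> {RV P >-> R}) : Prop := IsMfBm {
  mfBm_gaussian : gaussian_process P (fun p : 'I_d * R => B p.1 p.2 : T -> R);
  mfBm_centered : centered P (fun p : 'I_d * R => B p.1 p.2 : T -> R);
  mfBm_continuous : forall (i : 'I_d) (w : T), continuous (fun t : R => B i t w);
  mfBm_fBm : forall i : 'I_d, is_fBm P (H i) (fun t : R => B i t : T -> R);
  mfBm_selfsimilar : forall lambda : R, 0 < lambda ->
    same_fdd P (fun (p : 'I_d * R) w => B p.1 (lambda * p.2) w)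
               (fun (p : 'I_d * R) w => lambda `^ H p.1 * B p.1 p.2 w);
  mfBm_stationary_increments : forall h : R,
    same_fdd P (fun (p : 'I_d * R) w => B p.1 (p.2 + h) w - B p.1 h w)
               (fun (p : 'I_d * R) w => B p.1 p.2 w - B p.1 0 w);
  mfBm_normalized : forall i : 'I_d, variance P (B i 1) = 1%E }.

Definition correlation (disp : measure_display) (T : measurableType disp)
    (R : realType) (P : probability T R) (X Y : T -> R) : R :=
  fine (covariance P X Y) /
  (Num.sqrt (fine (variance P X)) * Num.sqrt (fine (variance P Y))).

(* Unlike [Num.sg], [sign 0 = 1]. *)
Definition sign (R : realType) (x : R) : R := if 0 <= x then 1 else -1.

(* [ln 0 = 0] in the library, which agrees with 0 log 0 = 0. *)
Definition mfBm_cov (R : realType) (h rho eta t s : R) : R :=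
  if h == 1 then
    2^-1 * (rho * (`|s| + `|t| - `|s - t|) +
            eta * (s * ln `|s| - t * ln `|t| - (s - t) * ln `|s - t|))
  else
    2^-1 * ((rho + sign t * eta) * `|t| `^ h +
            (rho - sign s * eta) * `|s| `^ h -
            (rho - sign (s - t) * eta) * `|s - t| `^ h).

Record mfBm_params (disp : measure_display) (T : measurableType disp)
    (R : realType) (P : probability T R) (d : nat) (H : 'I_d -> R)
    (B : 'I_d -> R -> {RV P >-> R}) (rho eta : 'I_d -> 'I_d -> R) : Prop :=
  MfBmParams {
  rho_sym : forall i j : 'I_d, i != j -> rho i j = rho j i;
  rho_bound : forall i j : 'I_d, i != j -> -1 <= rho i j <= 1;
  eta_antisym : forall i j : 'I_d, i != j -> eta i j = - eta j i;
  rho_corr : forall i j : 'I_d, i != j ->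
    rho i j = correlation P (B i 1) (B j 1);
  mfBm_covE : forall i j : 'I_d, i != j -> forall t s : R,
    covariance P (B i t) (B j s) =
    (mfBm_cov (H i + H j) (rho i j) (eta i j) t s)%:E }.

(* The Riemann-Stieltjes integral of f against g over [a, b] is [l].  The
   partition is a = x_0 < x_1 < .. < x_n = b with [s = [:: x_1; ..; x_n]] as in
   [itv_partition], so that [nth b (a :: s) k] is x_k; the tags are [xi]. *)
Definition is_RS_integral (R : realType) (f g : R -> R) (a b l : R) : Prop :=
  forall eps : R, 0 < eps -> exists2 delta : R, 0 < delta &
    forall (s : seq R) (xi : nat -> R),
      itv_partition a b s ->
      (forall k : nat, (k < size s)%N ->
         nth b (a :: s) k.+1 - nth b (a :: s) k < delta /\
         nth b (a :: s) k <= xi k <= nth b (a :: s) k.+1) ->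
      `| \sum_(k < size s)
           f (xi k) * (g (nth b (a :: s) k.+1) - g (nth b (a :: s) k)) - l | < eps.

Definition is_RS_integral_ninfty (R : realType) (f g : R -> R) (b l : R) : Prop :=
  exists2 J : R -> R, (forall a : R, a <= b -> is_RS_integral f g a b (J a)) &
    J a @[a --> -oo] --> l.

Definition is_mfOU (disp : measure_display) (T : measurableType disp)
    (R : realType) (P : probability T R) (d : nat) (alpha nu : 'I_d -> R)
    (B Y : 'I_d -> R -> {RV P >-> R}) : Prop :=
  forall (i : 'I_d) (t : R), {ae P, forall w : T,
    exists2 l : R,
      is_RS_integral_ninfty (fun u => expR (- alpha i * (t - u)))
        (fun u => B i u w) t l &
      Y i t w = nu i * l}.

(* Lets the Landau notations of the library be used at +oo. *)
Canonical pinfty_filter_on (R : realType) : filter_on R :=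
  FilterType (pinfty_nbhs R) _.

(* Main.v *)
Require Import Defs.
From HB Require Import structures.
From mathcomp Require Import all_boot all_order all_algebra.
From mathcomp Require Import all_classical all_reals all_analysis.
From mathcomp Require Import measurable_realfun.
From mathcomp Require Import ring lra.
Set Implicit Arguments.
Unset Strict Implicit.
Unset Printing Implicit Defensive.
Import Order.TTheory GRing.Theory Num.Theory.
Import numFieldNormedType.Exports.
Local Open Scope classical_set_scope.
Local Open Scope ring_scope.

(** Formally, Y^i_t is the integral over x > 0 of nu_i e^(-a x) dB^i_(t-x), and
    for r > 0 the mixed derivative of the covariance of B^i and B^j is a function
    k(r) of the time lag only, namely a multiple of r^p with p = H_ij - 2.  So
    Cov(Y^i_t, Y^j_(t+s)) is nu_i nu_j times the integral of
    e^(-a x) e^(-b y) k(s + x - y), where a and b are the rates alpha_i and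
    alpha_j.  Taylor expansion of k at s turns this operator into the power
    series of 1/((a - D)(b + D)) in D = d/ds, whose coefficients are
    c_n = ((-1)^n / b^(n+1) + 1 / a^(n+1)) / (a + b); the terms c_n k^(n)(s) are
    those of the theorem.

    The proof makes this rigorous without double integrals.

    Localization.  Y_t is e^(-a s/2) Y_(t-s/2) plus the contribution [innov] of
    the noise on [t - s/2, t], and likewise for Y^j_(t+s) on [t + s/2, t + s].
    The processes are bounded in L2 uniformly in time ([OU_L2le]), so that up to
    an exponentially small error only the two contributions matter, and the time
    lag of their noises is at least s/2: the singularity of k at 0 and the
    other branch of the covariance are never seen.

    From sample paths to covariances.  The contributions are almost sure limits
    of Riemann-Stieltjes sums.  Summation by parts bounds these sums in L2
    ([fBm_usum_L2le]), and an almost sure limit of an L2 bounded sequence is a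
    weak limit ([L2dot_lim]).  Hence the covariance of the two contributions is
    an iterated limit of double sums of mixed differences of the covariance of
    B^i and B^j.

    Evaluation of the double sums.  Let m be the sum of c_n k^(n) for n <= N.
    The function M(u, v) = e^(-a(t-u)) e^(-b(t+s-v)) m(v - u) has the mixed
    derivative e^(-a(t-u)) e^(-b(t+s-v)) ((a - D)(b + D) m)(v - u), and
    (a - D)(b + D) m = k up to derivatives of k of order above N
    ([expansion_residual]).  A comparison of mixed differences cell by cell
    ([cell_le], [usum2_le]) shows that the double sums are close to the mixed
    difference of M over the whole rectangle.  One of its four corners
    contributes m(s), the others are exponentially small. *)

(** * The inner product of L2 *)

Section L2.
Context (disp : measure_display) (T : measurableType disp) (R : realType).
Variable P : probability T R.
Implicit Types X Y Z : T -> R.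

Local Notation L2 := (Lfun P 2%:E).

Definition L2dot X Y : R := fine (expectation P (X \* Y)).

Lemma L2_measurable X : X \in L2 -> measurable_fun setT X.
Proof. by rewrite inE => /andP[/[!inE]]. Qed.

Lemma L2_integrable_mul X Y : X \in L2 -> Y \in L2 ->
  P.-integrable setT (EFin \o (X \* Y)).
Proof. by move=> hX hY; apply/Lfun1_integrable; exact: Lfun2_mul_Lfun1. Qed.

Lemma L2dotE X Y : X \in L2 -> Y \in L2 ->
  expectation P (X \* Y) = (L2dot X Y)%:E.
Proof.
move=> hX hY; rewrite /L2dot fineK// expectation_fin_num//.
exact: Lfun2_mul_Lfun1.
Qed.

Lemma L2P X : measurable_fun setT X ->
  (\int[P]_w ((X w) ^+ 2)%:E < +oo)%E -> X \in L2.
Proof.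
move=> mX iX; rewrite inE; apply/andP; split; rewrite inE //=.
rewrite /finite_norm unlock poweR_lty//.
rewrite (_ : (\int[P]_x _)%E = (\int[P]_w ((X w) ^+ 2)%:E)%E)//.
by apply: eq_integral => w _ /=; rewrite -real_normK ?num_real// powR_mulrn.
Qed.

Lemma L2_cst c : cst c \in L2. Proof. exact: Lfun_cst. Qed.

Lemma L2D X Y : X \in L2 -> Y \in L2 -> X \+ Y \in L2.
Proof. by move=> hX hY; rewrite rpredD ?lee1n. Qed.

Lemma L2Z c X : X \in L2 -> (fun w => c * X w) \in L2.
Proof.
move=> hX; rewrite (_ : (fun w => c * X w) = c \o* X); last first.
  by apply/funext => w /=; rewrite mulrC.
by apply: Lfun_scale => //; rewrite ler1n.
Qed.

Lemma L2_sum (n : nat) (c : 'I_n -> R) (X : 'I_n -> T -> R) :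
  (forall k, X k \in L2) -> (fun w => \sum_(k < n) c k * X k w) \in L2.
Proof.
elim: n c X => [|n IH] c X hX.
  rewrite (_ : (fun _ => _) = cst 0); first exact: L2_cst.
  by apply/funext => w; rewrite big_ord0.
rewrite (_ : (fun _ => _) = (fun w => c ord0 * X ord0 w) \+
    (fun w => \sum_(k < n) c (lift ord0 k) * X (lift ord0 k) w)); last first.
  by apply/funext => w; rewrite big_ord_recl.
by apply: L2D; [exact: L2Z|exact: (IH _ (fun k => X (lift ord0 k)))].
Qed.

Lemma L2dotC X Y : L2dot X Y = L2dot Y X.
Proof.
by rewrite /L2dot; congr (fine (expectation _ _)); apply/funext => w /=; rewrite mulrC.
Qed.

Lemma L2dotDl X Y Z : X \in L2 -> Y \in L2 -> Z \in L2 ->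
  L2dot (X \+ Y) Z = L2dot X Z + L2dot Y Z.
Proof.
move=> hX hY hZ; apply: EFin_inj; rewrite EFinD -!L2dotE ?L2D//.
rewrite -expectationD ?Lfun2_mul_Lfun1//; congr expectation.
by apply/funext => w /=; rewrite mulrDl.
Qed.

Lemma L2dotZl c X Y : X \in L2 -> Y \in L2 ->
  L2dot (fun w => c * X w) Y = c * L2dot X Y.
Proof.
move=> hX hY; apply: EFin_inj; rewrite EFinM -!L2dotE ?L2Z//.
rewrite -expectationZl ?Lfun2_mul_Lfun1//; congr expectation.
by apply/funext => w /=; rewrite -mulrA mulrC.
Qed.

Lemma L2dotDr X Y Z : X \in L2 -> Y \in L2 -> Z \in L2 ->
  L2dot Z (X \+ Y) = L2dot Z X + L2dot Z Y.
Proof. by move=> hX hY hZ; rewrite L2dotC L2dotDl// !(L2dotC Z). Qed.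

Lemma L2dotZr c X Y : X \in L2 -> Y \in L2 ->
  L2dot Y (fun w => c * X w) = c * L2dot Y X.
Proof. by move=> hX hY; rewrite L2dotC L2dotZl// L2dotC. Qed.

Lemma L2dot_suml (n : nat) (c : 'I_n -> R) (X : 'I_n -> T -> R) Y :
  (forall k, X k \in L2) -> Y \in L2 ->
  L2dot (fun w => \sum_(k < n) c k * X k w) Y = \sum_(k < n) c k * L2dot (X k) Y.
Proof.
move=> + hY; elim: n c X => [|n IH] c X hX.
  rewrite big_ord0 (_ : (fun _ => _) = (fun w => 0 * 0)); last first.
    by apply/funext => w; rewrite big_ord0 mul0r.
  by rewrite (@L2dotZl 0 (cst 0))// ?mul0r// L2_cst.
rewrite (_ : (fun _ => _) = (fun w => c ord0 * X ord0 w) \+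
    (fun w => \sum_(k < n) c (lift ord0 k) * X (lift ord0 k) w)); last first.
  by apply/funext => w; rewrite big_ord_recl.
rewrite L2dotDl ?L2Z//; last exact: (L2_sum _ (fun k => hX (lift ord0 k))).
by rewrite L2dotZl// (IH _ (fun k => X (lift ord0 k)))// [RHS]big_ord_recl.
Qed.

Lemma L2dot_sumr (n : nat) (c : 'I_n -> R) (X : 'I_n -> T -> R) Y :
  (forall k, X k \in L2) -> Y \in L2 ->
  L2dot Y (fun w => \sum_(k < n) c k * X k w) = \sum_(k < n) c k * L2dot Y (X k).
Proof.
move=> hX hY; rewrite L2dotC L2dot_suml//.
by apply: eq_bigr => k _; rewrite L2dotC.
Qed.

Lemma L2dot_ge0 X : 0 <= L2dot X X.
Proof. by rewrite /L2dot fine_ge0// expectation_ge0// => w; exact: sqr_ge0. Qed.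

(** Membership in the ball of radius [c] of L2, without square roots. *)
Definition L2le X (c : R) := X \in L2 /\ L2dot X X <= c ^+ 2.

(** The Cauchy-Schwarz inequality. *)
Lemma L2dot_le X Y a b : 0 <= a -> 0 <= b -> L2le X a -> L2le Y b ->
  `|L2dot X Y| <= a * b.
Proof.
move=> a0 b0 [hX Xa] [hY Yb].
have key (u v : R) : 0 <= u ^+ 2 * L2dot X X + 2 * (u * v) * L2dot X Y + v ^+ 2 * L2dot Y Y.
  have := L2dot_ge0 ((fun w => u * X w) \+ (fun w => v * Y w)).
  rewrite L2dotDl ?L2D ?L2Z// !L2dotDr ?L2Z// !(L2dotZl, L2dotZr) ?L2Z//.
  by rewrite (L2dotC Y X) => /le_trans; apply; rewrite le_eqVlt; apply/orP; left; apply/eqP; ring.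
have X0 := L2dot_ge0 X; have Y0 := L2dot_ge0 Y.
apply/ler_addgt0Pr => e e0.
(* The quadratic form [key] is used at u = b and v = +- a; as a and b may
   vanish, both are first enlarged by e1. *)
pose e1 : R := e / (a + b + e + 1).
have d0 : 0 < a + b + e + 1 by lra.
have e10 : 0 < e1 by rewrite divr_gt0.
have e11 : e1 <= 1 by rewrite ler_pdivrMr// mul1r; lra.
have e1e : (a + e1) * (b + e1) <= a * b + e.
  have : e1 * (a + b + e + 1) = e by rewrite /e1 divfK// gt_eqF.
  by nra.
apply: le_trans e1e.
have h1 := key (b + e1) (a + e1).
have := key (b + e1) (- (a + e1)); rewrite sqrrN => h2.
have p1 : 0 < (a + e1) * (b + e1) by rewrite mulr_gt0//; lra.
have q1 : (b + e1) ^+ 2 * L2dot X X <= (b + e1) ^+ 2 * (a + e1) ^+ 2.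
  by rewrite ler_wpM2l ?sqr_ge0// (le_trans Xa)// ler_pXn2r ?nnegrE//; lra.
have q2 : (a + e1) ^+ 2 * L2dot Y Y <= (a + e1) ^+ 2 * (b + e1) ^+ 2.
  by rewrite ler_wpM2l ?sqr_ge0// (le_trans Yb)// ler_pXn2r ?nnegrE//; lra.
rewrite -(ler_pM2l p1); move: (L2dot X Y) h1 h2 q1 q2 => z h1 h2 q1 q2.
rewrite -{1}(gtr0_norm p1) -normrM ler_norml.
move: ((b + e1)^+2 * L2dot X X) ((a + e1)^+2 * L2dot Y Y) h1 h2 q1 q2 => p q.
by move=> h1 h2 q1 q2; apply/andP; split; lra.
Qed.

Lemma L2leD X Y a b : 0 <= a -> 0 <= b -> L2le X a -> L2le Y b ->
  L2le (X \+ Y) (a + b).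
Proof.
move=> a0 b0 hX hY; have := L2dot_le a0 b0 hX hY; rewrite ler_norml => /andP[_ hc].
move: hX hY => [hX Xa] [hY Yb]; split; first exact: L2D.
rewrite L2dotDl ?L2D// !L2dotDr// (L2dotC Y X) sqrrD.
by move: Xa Yb hc; rewrite mulr2n; lra.
Qed.

Lemma L2leZ c X a : L2le X a -> L2le (fun w => c * X w) (`|c| * a).
Proof.
move=> [hX Xa]; split; first exact: L2Z.
rewrite L2dotZl ?L2Z// L2dotZr// exprMn real_normK ?num_real// mulrA -expr2.
by rewrite ler_wpM2l ?sqr_ge0.
Qed.

Lemma L2le_cst1 : L2le (cst 1) 1.
Proof.
split; first exact: L2_cst.
rewrite -lee_fin -L2dotE ?L2_cst//.
rewrite (_ : cst 1 \* cst 1 = cst 1); last by apply/funext => w /=; rewrite mulr1.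
by rewrite expectation_cst expr1n.
Qed.

Lemma L2le_weaken X a b : 0 <= a -> a <= b -> L2le X a -> L2le X b.
Proof.
move=> a0 ab [hX Xa]; split=> //; apply: le_trans Xa _.
by rewrite ler_pXn2r ?nnegrE// (le_trans a0).
Qed.

Lemma L2le_sum (n : nat) (c a : 'I_n -> R) (X : 'I_n -> T -> R) :
  (forall k, 0 <= a k) -> (forall k, L2le (X k) (a k)) ->
  L2le (fun w => \sum_(k < n) c k * X k w) (\sum_(k < n) `|c k| * a k).
Proof.
elim: n c a X => [|n IH] c a X a0 hX.
  rewrite big_ord0 (_ : (fun _ => _) = (fun w => 0 * 0)); last first.
    by apply/funext => w; rewrite big_ord0 mul0r.
  have h0 := @L2Z 0 (cst 0) (L2_cst 0); split=> //.
  by rewrite (@L2dotZl 0 (cst 0))// ?mul0r ?expr0n// L2_cst.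
rewrite (_ : (fun _ => _) = (fun w => c ord0 * X ord0 w) \+
    (fun w => \sum_(k < n) c (lift ord0 k) * X (lift ord0 k) w)); last first.
  by apply/funext => w; rewrite big_ord_recl.
rewrite big_ord_recl; apply: L2leD.
- by rewrite mulr_ge0.
- by apply: sumr_ge0 => k _; rewrite mulr_ge0.
- exact: L2leZ.
- exact: (IH _ (fun k => a (lift ord0 k)) (fun k => X (lift ord0 k))).
Qed.
End L2.

(** * Almost sure limits of L2 bounded sequences *)

Section L2_limits.
Context (disp : measure_display) (T : measurableType disp) (R : realType).
Variable P : probability T R.
Implicit Types X Y Z : T -> R.

Local Notation L2 := (Lfun P 2%:E).

Lemma limn_einf_le (u : (\bar R)^nat) (c : \bar R) :
  (forall n, u n <= c)%E -> (limn_einf u <= c)%E.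
Proof.
move=> uc; rewrite limn_einf_lim; apply: lime_le; first exact: is_cvg_einfs.
apply: nearW => n; apply: le_trans (uc n).
by apply: ereal_inf_lbound; exists n => /=.
Qed.

(** Fatou's lemma for the squares. *)
Lemma L2le_lim (X_ : nat -> T -> R) X (C : R) :
  measurable_fun setT X -> (forall n, L2le P (X_ n) C) ->
  {ae P, forall w, X_ n w @[n --> \oo] --> X w} -> L2le P X C.
Proof.
move=> mX hX cX.
have mX_ n : measurable_fun setT (fun w => ((X_ n w) ^+ 2)%:E).
  by apply/measurable_EFinP; apply: measurable_funX; exact: (L2_measurable (hX n).1).
have mX2 : measurable_fun setT (fun w => ((X w) ^+ 2)%:E).
  by apply/measurable_EFinP; exact: measurable_funX.
have le : (\int[P]_w ((X w) ^+ 2)%:E <= (C ^+ 2)%:E)%E.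
  apply: (@le_trans _ _ (\int[P]_w limn_einf (fun n => ((X_ n w) ^+ 2)%:E))%E).
    apply: ae_ge0_le_integral => //.
    - by move=> w _; rewrite lee_fin sqr_ge0.
    - move=> w _; rewrite limn_einf_lim; apply: lime_ge; first exact: is_cvg_einfs.
      apply: nearW => n; apply: le_ereal_inf_tmp => _ [m _ <-].
      by rewrite lee_fin sqr_ge0.
    - rewrite /limn_einf; apply: measurableT_comp => //.
      apply: measurable_fun_limn_esup => n.
      exact: measurableT_comp.
    - apply: filterS cX => w cw _.
      have cw2 : ((X_ n w) ^+ 2)%:E @[n --> \oo] --> ((X w) ^+ 2)%:E.
        by apply: cvg_EFin; [exact: nearW|exact: (cvgM cw cw)].
      rewrite is_cvg_limn_einfE; last by apply/cvg_ex; exists ((X w)^+2)%:E.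
      by rewrite (cvg_lim _ cw2).
  apply: le_trans (fatou P measurableT mX_ _) _.
    by move=> n w _; rewrite lee_fin sqr_ge0.
  apply: limn_einf_le => n; have [h1 h2] := hX n.
  rewrite (_ : (\int[P]_x _)%E = (L2dot P (X_ n) (X_ n))%:E) ?lee_fin//.
  by rewrite -L2dotE// unlock.
have hX2 : X \in L2 by apply: L2P => //; exact: le_lt_trans le (ltry _).
split=> //; rewrite -lee_fin -L2dotE// unlock; exact: le.
Qed.

(** The product |D Z| is at most min(|D Z|, M Z^2) + D^2 / M, according to
    whether |D| <= M |Z|: dominated convergence takes care of the first summand
    and the L2 bound of the second one. *)
Lemma L2dot_lim0 (D : nat -> T -> R) (C : R) Z : 0 <= C ->
  (forall n, L2le P (D n) C) -> Z \in L2 ->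
  {ae P, forall w, D n w @[n --> \oo] --> 0} ->
  L2dot P (D n) Z @[n --> \oo] --> 0.
Proof.
move=> C0 hD hZ cD.
have mD n := L2_measurable (hD n).1; have mZ := L2_measurable hZ.
pose g (M : R) n w : R := Num.min (`|D n w * Z w|) (M * (Z w * Z w)).
have mZZ (M : R) : measurable_fun setT (fun w => M * (Z w * Z w)).
  by apply: measurable_funM => //; exact: measurable_funM.
have mDZ n : measurable_fun setT (fun w => `|D n w * Z w|).
  by apply: measurableT_comp => //; exact: measurable_funM.
have mg M n : measurable_fun setT (g M n) by exact: measurable_minr.
have g0 (M : R) n w : 0 <= M -> 0 <= g M n w.
  by move=> M0; rewrite /g le_min normr_ge0 mulr_ge0// -expr2 sqr_ge0.
have glim (M : R) : 0 < M -> (\int[P]_w (g M n w)%:E @[n --> \oo] --> 0)%E.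
  move=> M0.
  have iZ : P.-integrable setT (fun w => (M * (Z w * Z w))%:E).
    have := integrableZl measurableT M (L2_integrable_mul hZ hZ).
    by apply: eq_integrable.
  have [] := @dominated_convergence _ _ _ P setT measurableT
    (fun n w => (g M n w)%:E) (cst 0%E) _ _ _ _ iZ _ => //.
  - by move=> n; exact/measurable_EFinP.
  - apply: filterS cD => w cw _; apply: cvg_EFin; first exact: nearW.
    apply: (@squeeze_cvgr _ _ _ _ (cst 0) (fun n => `|D n w * Z w|)).
    + apply: nearW => n; apply/andP; split; first exact/g0/ltW.
      by rewrite /= /g ge_min lexx.
    + exact: cvg_cst.
    + rewrite [X in _ --> X](_ : 0 = `|0 * Z w|); last by rewrite mul0r normr0.
      by apply: cvg_norm; apply: cvgMl.
  - apply: aeW => w n _; rewrite gee0_abs; last by rewrite lee_fin g0// ltW.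
    by rewrite lee_fin /g ge_min lexx orbT.
  - by move=> _ _; rewrite integral0; exact.
apply/cvgr0Pnorm_le => e e0 /=.
pose M : R := 2 * (C ^+ 2 + 1) / e.
have C2 := sqr_ge0 C.
have M0 : 0 < M by rewrite divr_gt0// mulr_gt0// ltr_wpDl.
have e2 : 0 < e / 2 by rewrite divr_gt0.
have /fine_cvgP[_ /cvgr0Pnorm_le /(_ _ e2)] := glim _ M0.
apply: filterS => n /= gn.
have ig : P.-integrable setT (fun w => (g M n w)%:E).
  apply: (le_integrable measurableT _ _ (integrable_abse (L2_integrable_mul (hD n).1 hZ))).
    exact/measurable_EFinP.
  move=> w _ /=; rewrite !lee_fin normr_id ger0_norm; last exact/g0/ltW.
  by rewrite /g ge_min lexx.
have iD : P.-integrable setT (fun w => (M^-1 * (D n w * D n w))%:E).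
  have := integrableZl measurableT M^-1 (L2_integrable_mul (hD n).1 (hD n).1).
  by apply: eq_integrable.
have iDE : (\int[P]_w (M^-1 * (D n w * D n w))%:E = (M^-1 * L2dot P (D n) (D n))%:E)%E.
  have hd := L2_integrable_mul (hD n).1 (hD n).1.
  rewrite EFinM -L2dotE ?(hD n).1// unlock -integralZl//.
rewrite -lee_fin -abse_EFin -L2dotE ?(hD n).1// unlock.
apply: le_trans (le_abse_integral _ measurableT _) _.
  by apply/measurable_EFinP; exact: measurable_funM.
apply: (@le_trans _ _ (\int[P]_w ((g M n w)%:E + (M^-1 * (D n w * D n w))%:E))%E).
  apply: ge0_le_integral => //.
  - by apply: measurableT_comp => //; apply/measurable_EFinP; exact: measurable_funM.
  - by apply: emeasurable_funD; [exact: (measurable_int P ig)|exact: (measurable_int P iD)].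
  - move=> w _ /=; rewrite lee_fin /g; set x := D n w; set z := Z w.
    have M1 : 0 < M^-1 by rewrite invr_gt0.
    case: (leP `|x * z| (M * (z * z))) => [h|h].
      by rewrite lerDl; apply: mulr_ge0; [exact: ltW|exact: sqr_ge0].
    have -> : x * x = `|x| ^+ 2 by rewrite real_normK// num_real.
    have zM : z * z = `|z| * `|z| by rewrite -normrM ger0_norm// -expr2 sqr_ge0.
    move: h; rewrite zM normrM.
    move=> h; have [xz|xz] := leP `|x| (M * `|z|).
      have := ler_wpM2r (normr_ge0 z) xz; rewrite -mulrA => xz'.
      by move: (lt_le_trans h xz'); rewrite ltxx.
    have xz' : `|z| <= M^-1 * `|x| by rewrite mulrC ler_pdivlMr// mulrC ltW.
    apply: (@le_trans _ _ (M^-1 * `|x| ^+ 2)); last first.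
      by rewrite lerDr mulr_ge0// ltW.
    by rewrite expr2 mulrA [leRHS]mulrC ler_wpM2l.
rewrite integralD// iDE -(fineK (integrable_fin_num measurableT ig)) -EFinD lee_fin.
move: gn; rewrite ler_norml => /andP[_ gn].
have : M^-1 * L2dot P (D n) (D n) <= e / 2.
  apply: (@le_trans _ _ (M^-1 * (C ^+ 2 + 1))).
    rewrite ler_wpM2l ?invr_ge0 ?ltW//; have := (hD n).2; lra.
  rewrite /M invf_div mulrAC -mulf_div divff ?mulr1; last by rewrite gt_eqF// ltr_wpDl.
  by [].
by move: gn; lra.
Qed.

(** Almost sure convergence and an L2 bound give weak convergence in L2. *)
Lemma L2dot_lim (X_ : nat -> T -> R) X (C : R) Z : 0 <= C ->
  measurable_fun setT X -> (forall n, L2le P (X_ n) C) ->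
  {ae P, forall w, X_ n w @[n --> \oo] --> X w} -> Z \in L2 ->
  L2dot P (X_ n) Z @[n --> \oo] --> L2dot P X Z.
Proof.
move=> C0 mX hX cX hZ.
have hXl := L2le_lim mX hX cX.
pose D n := X_ n \+ (fun w => -1 * X w).
have hD n : L2le P (D n) (C + `|-1| * C).
  by apply: L2leD => //; [rewrite mulr_ge0|exact: L2leZ].
have DE : (fun n => L2dot P (X_ n) Z) = (fun n => L2dot P (D n) Z + L2dot P X Z).
  apply/funext => n.
  by rewrite L2dotDl ?L2Z ?(hX n).1 ?hXl.1// L2dotZl ?hXl.1// mulN1r subrK.
rewrite DE -[X in _ --> X]add0r; apply: cvgD; last exact: cvg_cst.
apply: (L2dot_lim0 _ hD) => //; first by rewrite addr_ge0// mulr_ge0.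
apply: filterS cX => w cw; rewrite /D/=.
rewrite [X in _ --> X](_ : 0 = X w + -1 * X w); last by rewrite mulN1r subrr.
by apply: cvgD => //; exact: cvg_cst.
Qed.
End L2_limits.

(** * Riemann-Stieltjes sums over uniform partitions *)

Section RiemannStieltjes.
Context (R : realType).
Implicit Types (f g : R -> R) (a b c l : R) (s : seq R).

Definition unode a b (n k : nat) : R := a + k%:R * ((b - a) / n%:R).

Definition usum f g a b (n : nat) : R :=
  \sum_(k < n) f (unode a b n k) * (g (unode a b n k.+1) - g (unode a b n k)).

(** The sum with left tags by recursion on the partition, which makes the
    concatenation of partitions transparent. *)
Fixpoint lsum f g a s : R :=
  if s is x :: s' then f a * (g x - g a) + lsum f g x s' else 0.

Lemma lsumE f g a b s :
  \sum_(k < size s) f (nth b (a :: s) k) *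
    (g (nth b (a :: s) k.+1) - g (nth b (a :: s) k)) = lsum f g a s.
Proof.
elim: s a => [|x s IH] a; first by rewrite big_ord0.
by rewrite /= big_ord_recl /= -IH; congr (_ + _).
Qed.

Lemma lsum_cat f g a s1 s2 :
  lsum f g a (s1 ++ s2) = lsum f g a s1 + lsum f g (last a s1) s2.
Proof. by elim: s1 a => [|x s IH] a /=; rewrite ?add0r// IH addrA. Qed.

Lemma RS_lsum f g a b l : is_RS_integral f g a b l ->
  forall eps, 0 < eps -> exists2 delta, 0 < delta &
    forall s, itv_partition a b s -> path (fun x y => y - x < delta) a s ->
      `|lsum f g a s - l| < eps.
Proof.
move=> h eps e0; have [delta d0 hd] := h eps e0; exists delta => // s ps ms.
rewrite -(lsumE _ _ _ b); apply: (hd s (nth b (a :: s))) => // k ks.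
have := (pathP b ms) k ks; split => //=; rewrite lexx/=.
by apply: ltW; exact: (pathP b ps.1).
Qed.

Definition useq a b n := [seq unode a b n k | k <- iota 1 n].

Lemma unode0 a b n : unode a b n 0 = a.
Proof. by rewrite /unode mul0r addr0. Qed.

Lemma unode_last a b n : unode a b n.+1 n.+1 = b.
Proof. by rewrite /unode mulrCA divff ?pnatr_eq0// mulr1 addrC subrK. Qed.

Lemma unodeS a b n k : unode a b n k.+1 - unode a b n k = (b - a) / n%:R.
Proof. by rewrite /unode -natr1; ring. Qed.

Lemma unode_le a b (n k q : nat) : a <= b -> (k <= q)%N ->
  unode a b n k <= unode a b n q.
Proof.
move=> ab kl; rewrite /unode lerD2l ler_wpM2r ?ler_nat//.
by rewrite divr_ge0// subr_ge0.
Qed.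

Lemma nth_useq a b n k : (k <= n.+1)%N ->
  nth b (a :: useq a b n.+1) k = unode a b n.+1 k.
Proof.
case: k => [|k] kn; first by rewrite unode0.
by rewrite /= (nth_map 0%N) ?size_iota// nth_iota.
Qed.

Lemma size_useq a b n : size (useq a b n) = n.
Proof. by rewrite size_map size_iota. Qed.

Lemma lsum_useq f g a b n : lsum f g a (useq a b n.+1) = usum f g a b n.+1.
Proof.
rewrite -(lsumE _ _ _ b) size_useq; apply: eq_bigr => k _.
by rewrite !nth_useq// ltnW.
Qed.

Lemma last_useq a b n : last a (useq a b n.+1) = b.
Proof.
by rewrite (last_nth b) size_useq nth_useq// unode_last.
Qed.

Lemma useq_partition a b n : a < b -> itv_partition a b (useq a b n.+1).
Proof.
move=> ab; split; last by rewrite last_useq.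
apply/(pathP b) => k; rewrite size_useq => kn.
rewrite -[nth b (useq _ _ _) k]/(nth b (a :: useq a b n.+1) k.+1).
rewrite !nth_useq//; last exact: ltnW.
by rewrite -subr_gt0 unodeS divr_gt0 ?subr_gt0.
Qed.

Lemma useq_mesh a b n delta : (b - a) / n.+1%:R < delta ->
  path (fun x y => y - x < delta) a (useq a b n.+1).
Proof.
move=> ab; apply/(pathP b) => k; rewrite size_useq => kn.
rewrite -[nth b (useq _ _ _) k]/(nth b (a :: useq a b n.+1) k.+1).
by rewrite !nth_useq ?unodeS// ltnW.
Qed.

Lemma near_mesh a b delta : 0 < delta ->
  \forall n \near \oo, (b - a) / n.+1%:R < delta.
Proof.
move=> d0; have h : (b - a) * harmonic n @[n --> \oo] --> (b - a) * 0.
  by apply: cvgMr; exact: cvg_harmonic.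
rewrite mulr0 in h; have /cvgr0Pnorm_lt/(_ _ d0) := h.
apply: filterS => n /=; rewrite ltr_norml => /andP[_]; exact.
Qed.

Lemma RS_usum_cvg f g a b l : a < b -> is_RS_integral f g a b l ->
  usum f g a b n.+1 @[n --> \oo] --> l.
Proof.
move=> ab h; apply/cvgrPdist_lt => e e0.
have [delta d0 hd] := RS_lsum h e0.
have := near_mesh a b d0; apply: filterS => n hn.
rewrite distrC -lsum_useq; apply: hd; [exact: useq_partition|exact: useq_mesh].
Qed.

Lemma cvgr_uniq (U : Type) (F : set_system U) (FF : ProperFilter F)
  (u : U -> R) l l' : u @ F --> l -> u @ F --> l' -> l = l'.
Proof. by move=> h1 h2; rewrite -(cvg_lim _ h1)// -(cvg_lim _ h2). Qed.

(** Uniform partitions of [a, b] and [b, c] together form an admissible, though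
    not uniform, partition of [a, c]. *)
Lemma RS_add f g a b c l l1 l2 : a < b -> b < c ->
  is_RS_integral f g a c l -> usum f g a b n.+1 @[n --> \oo] --> l1 ->
  usum f g b c n.+1 @[n --> \oo] --> l2 -> l = l1 + l2.
Proof.
move=> ab bc h h1 h2.
apply: (@cvgr_uniq _ \oo _ (fun n => usum f g a b n.+1 + usum f g b c n.+1));
  last exact: cvgD.
apply/cvgrPdist_lt => e e0; have [delta d0 hd] := RS_lsum h e0.
near=> n; rewrite distrC.
rewrite [X in `|X - _|](_ : _ =
    lsum f g a (useq a b n.+1 ++ useq b c n.+1)); last first.
  by rewrite lsum_cat last_useq !lsum_useq.
apply: hd.
  exact: itv_partition_cat (useq_partition n ab) (useq_partition n bc).
rewrite cat_path last_useq !useq_mesh//; near: n; exact: near_mesh.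
Unshelve. all: by end_near. Qed.

Lemma usumZ (k : R) f f' g a b n : (forall u, f u = k * f' u) ->
  usum f g a b n = k * usum f' g a b n.
Proof.
by move=> ff; rewrite /usum mulr_sumr; apply: eq_bigr => i _; rewrite ff mulrA.
Qed.

(** Additivity on [x, b] for every x < a, the weight [f] being [k] times the
    weight of the integral up to [a]; then x tends to -oo.  With exponential
    weights this is the Markov-like recursion of the Ornstein-Uhlenbeck process. *)
Lemma RS_ninfty_split f f' g a b k l l' : a < b ->
  (forall u, f u = k * f' u) ->
  is_RS_integral_ninfty f g b l -> is_RS_integral_ninfty f' g a l' ->
  usum f g a b n.+1 @[n --> \oo] --> l - k * l'.
Proof.
move=> ab ff [J hJ cJ] [J' hJ' cJ'].
rewrite (_ : l - k * l' = J a); first exact: RS_usum_cvg (hJ _ (ltW ab)).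
have JJ x : x < a -> J x = k * J' x + J a.
  move=> xa; have xb := lt_trans xa ab.
  apply: (RS_add xa ab (hJ x (ltW xb))); last exact: RS_usum_cvg (hJ a (ltW ab)).
  rewrite (_ : (fun n => _) = (fun n => k * usum f' g x a n.+1)).
    by apply: cvgMr; exact: RS_usum_cvg (hJ' x (ltW xa)).
  by apply/funext => n; rewrite (usumZ _ _ _ _ ff).
have c2 : k * J' x + J a @[x --> -oo] --> k * l' + J a.
  by apply: cvgD; [exact: cvgMr|exact: cvg_cst].
suff -> : l = k * l' + J a by rewrite addrC addKr.
apply: (cvgr_uniq _ _ c2).
apply: cvg_trans cJ; apply: near_eq_cvg.
by near do apply: JJ; apply: nbhs_ninfty_lt; rewrite num_real.
Unshelve. all: by end_near. Qed.
End RiemannStieltjes.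

(** * Mixed differences over rectangles *)

Section Derive.
Context (R : realType).
Implicit Types f g : R -> R.

Lemma deriveD_fun f g (x d e : R) : is_derive x 1 f d -> is_derive x 1 g e ->
  is_derive x 1 (fun x => f x + g x) (d + e).
Proof. by move=> hf hg; exact: is_deriveD. Qed.

Lemma deriveM_fun f g (x d e : R) : is_derive x 1 f d -> is_derive x 1 g e ->
  is_derive x 1 (fun x => f x * g x) (d * g x + f x * e).
Proof.
move=> hf hg; apply: is_derive_eq (is_deriveM hf hg) _.
by rewrite addrC mulrC.
Qed.

Lemma deriveZ_fun (c : R) f (x d : R) : is_derive x 1 f d ->
  is_derive x 1 (fun x => c * f x) (c * d).
Proof. by move=> hf; exact: is_deriveZ. Qed.

Lemma derive_cst_fun (c x : R) : is_derive x 1 (fun _ => c) 0.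
Proof. exact: is_derive_cst. Qed.

Lemma derive_comp_fun f g (x d e : R) : is_derive (g x) 1 f d ->
  is_derive x 1 g e -> is_derive x 1 (fun x => f (g x)) (d * e).
Proof. by move=> hf hg; exact: is_derive1_comp. Qed.

Lemma derive_comp_subr f (y x d : R) : is_derive (y - x) 1 f d ->
  is_derive x 1 (fun x => f (y - x)) (- d).
Proof.
move=> hf; have h : is_derive x 1 (fun x : R => y + -1 * x) (0 + -1 * 1).
  exact: (deriveD_fun (derive_cst_fun _ _) (deriveZ_fun _ (is_derive_id _ _))).
have e : (fun x : R => y + -1 * x) = (fun x => y - x).
  by apply/funext => z; rewrite mulN1r.
rewrite e in h; apply: (is_derive_eq (@derive_comp_fun f (fun x => y - x) _ _ _ hf h)).
by rewrite add0r mulr1 mulrN1.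
Qed.

Lemma derive_comp_subl f (c x d : R) : is_derive (x - c) 1 f d ->
  is_derive x 1 (fun x => f (x - c)) d.
Proof.
move=> hf; have h : is_derive x 1 (fun x : R => x + - c) (1 + 0).
  exact: (deriveD_fun (is_derive_id _ _) (derive_cst_fun _ _)).
by apply: (is_derive_eq (@derive_comp_fun f (fun x => x - c) _ _ _ hf h)); rewrite addr0 mulr1.
Qed.

Lemma derive_expR_lin (a c x : R) :
  is_derive x 1 (fun x => expR (- a * (c - x))) (a * expR (- a * (c - x))).
Proof.
have h : is_derive (c - x) 1 (fun z : R => expR (- a * z)) (expR (- a * (c - x)) * - a).
  have h1 : is_derive (c - x) 1 (fun z : R => - a * z) (- a * 1).
    exact: (deriveZ_fun _ (is_derive_id _ _)).
  have h2 := @derive_comp_fun expR (fun z => - a * z) _ _ _ (is_derive_expR _) h1.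
  by apply: (is_derive_eq h2); rewrite mulr1.
by apply: (is_derive_eq (derive_comp_subr h)); rewrite mulrN opprK mulrC.
Qed.

Lemma derive_ge0_le f f' (a b : R) : a <= b ->
  (forall x, a <= x <= b -> is_derive x 1 f (f' x)) ->
  (forall x, a <= x <= b -> 0 <= f' x) -> f a <= f b.
Proof.
move=> ab hf hf'; have [] := @MVT_segment _ f f' a b ab.
- by move=> x; rewrite in_itv/= => /andP[ax xb]; apply: hf; rewrite !ltW.
- apply: derivable_within_continuous => x; rewrite in_itv/= => hx.
  by apply: ex_derive; exact: hf.
- move=> c; rewrite in_itv/= => hc e; rewrite -subr_ge0 e.
  by rewrite mulr_ge0 ?hf'// subr_ge0.
Qed.

(** The mixed difference of [W] over a rectangle. *)
Definition box (W : R -> R -> R) (u u' v v' : R) : R :=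
  W u' v' - W u' v - (W u v' - W u v).

(** The monotonicity criterion by the derivative, in [y] for [Wu x] and then
    in [x] for W(x, v') - W(x, v). *)
Lemma box_ge0 (W Wu Wvu : R -> R -> R) (u u' v v' : R) : u <= u' -> v <= v' ->
  (forall x y, u <= x <= u' -> v <= y <= v' -> is_derive x 1 (W ^~ y) (Wu x y)) ->
  (forall x y, u <= x <= u' -> v <= y <= v' -> is_derive y 1 (Wu x) (Wvu x y)) ->
  (forall x y, u <= x <= u' -> v <= y <= v' -> 0 <= Wvu x y) ->
  0 <= box W u u' v v'.
Proof.
move=> uu vv hW hWu h0; rewrite /box subr_ge0.
have hv : v <= v <= v' by rewrite lexx.
have hv' : v <= v' <= v' by rewrite lexx andbT.
apply: (@derive_ge0_le (fun x => W x v' - W x v) (fun x => Wu x v' - Wu x v)) => // x hx.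
  have h := deriveZ_fun (-1) (hW _ _ hx hv).
  have e : (fun x => W x v' - W x v) = (fun x => W x v' + -1 * W x v).
    by apply/funext => z; rewrite mulN1r.
  rewrite e -[X in is_derive _ _ _ (_ - X)]mul1r -mulNr.
  by apply: deriveD_fun => //; exact: hW.
rewrite subr_ge0; apply: (derive_ge0_le vv (fun y hy => hWu x y hx hy)).
by move=> y hy; exact: h0.
Qed.

(** Mixed differences are additive over grids; this replaces the integration of
    mixed derivatives. *)
Lemma box_telescope (W : R -> R -> R) (x y : nat -> R) n m :
  \sum_(k < n) \sum_(l < m) box W (x k) (x k.+1) (y l) (y l.+1) =
  box W (x 0%N) (x n) (y 0%N) (y m).
Proof.
have inner k : \sum_(l < m) box W (x k) (x k.+1) (y l) (y l.+1) =
    (W (x k.+1) (y m) - W (x k.+1) (y 0%N)) - (W (x k) (y m) - W (x k) (y 0%N)).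
  rewrite -(big_mkord xpredT (fun l => box W (x k) (x k.+1) (y l) (y l.+1))).
  pose F l := W (x k.+1) (y l) - W (x k) (y l).
  rewrite (@telescope_sumr_eq _ _ _ F); first by rewrite /F; ring.
    by [].
  by move=> l _; rewrite /box /F; ring.
under eq_bigr do rewrite inner.
rewrite -(big_mkord xpredT (fun k => W (x k.+1) (y m) - W (x k.+1) (y 0%N) -
  (W (x k) (y m) - W (x k) (y 0%N)))).
by rewrite (@telescope_sumr _ 0%N n (fun k => W (x k) (y m) - W (x k) (y 0%N))).
Qed.
End Derive.

(** * Double sums over a rectangle away from the diagonal *)

Section Rectangle.
Context (R : realType).
Variables (a b t1 t2 x0 y0 K K1 : R) (kap kap1 k m m1 m2 : R -> R).
Hypotheses (a0 : 0 < a) (b0 : 0 < b) (K0 : 0 <= K) (K10 : 0 <= K1).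
Hypotheses (x0t1 : x0 < t1) (t1y0 : t1 < y0) (y0t2 : y0 < t2).
Hypothesis dkap : forall r : R, 0 < r -> is_derive r 1 kap (kap1 r).
Hypothesis dkap1 : forall r : R, 0 < r -> is_derive r 1 kap1 (- k r).
Hypothesis dm : forall r : R, 0 < r -> is_derive r 1 m (m1 r).
Hypothesis dm1 : forall r : R, 0 < r -> is_derive r 1 m1 (m2 r).
Hypothesis km : forall r : R, y0 - t1 <= r ->
  `|a * b * m r + (a - b) * m1 r - m2 r - k r| <= K.
Hypothesis kK1 : forall r : R, y0 - t1 <= r -> `|k r| <= K1.

(* The rectangle is [x0, t1] x [y0, t2], on which v - u is at least y0 - t1. *)
Let f u : R := expR (- a * (t1 - u)).
Let g v : R := expR (- b * (t2 - v)).
Let Q u v : R := kap (v - u).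
Let M u v : R := f u * g v * m (v - u).

Lemma expR_lip (c t u v : R) : 0 < c -> u <= v -> v <= t ->
  0 <= expR (- c * (t - v)) - expR (- c * (t - u)) <= c * (v - u).
Proof.
move=> c0 uv vt; apply/andP; split.
  by rewrite subr_ge0 ler_expR; nra.
have e1 : expR (- c * (t - v)) <= 1 by rewrite -expR0 ler_expR; nra.
have -> : - c * (t - u) = - c * (t - v) + - (c * (v - u)) by ring.
rewrite expRD -{1}[expR (- c * (t - v))]mulr1 -mulrBr.
have h1 : 1 - expR (- (c * (v - u))) <= c * (v - u).
  by have := expR_ge1Dx (- (c * (v - u))); lra.
have h2 : 0 <= c * (v - u) by rewrite mulr_ge0 ?subr_ge0// ltW.
by have := expR_ge0 (- c * (t - v)); nra.
Qed.

(** The mixed derivatives of F G Q and of M differ by at most K f g, which is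
    the mixed derivative of K f g / (a b), plus the error made by freezing the
    weights at the corner (u, v).  Stating the bound by mixed differences lets
    the main part telescope. *)
Lemma cell_le (u u' v v' : R) : x0 <= u -> u <= u' -> u' <= t1 ->
  y0 <= v -> v <= v' -> v' <= t2 ->
  `|f u * g v * box Q u u' v v' - box M u u' v v'| <=
  K / (a * b) * box (fun x y => f x * g y) u u' v v' +
  (a * (u' - u) + b * (v' - v)) * K1 * ((u' - u) * (v' - v)).
Proof.
move=> xu uu ut yv vv vt; have A0 := a0; have B0 := b0; have T1 := t1y0.
pose eps := a * (u' - u) + b * (v' - v).
have df (x : R) : is_derive x 1 f (a * f x) by exact: derive_expR_lin.
have dg (y : R) : is_derive y 1 g (b * g y) by exact: derive_expR_lin.
(* Both signs of the absolute value are treated at once. *)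
suff main (sg : R) : (sg == 1) || (sg == -1) ->
    0 <= K / (a * b) * box (fun x y => f x * g y) u u' v v' +
      eps * K1 * ((u' - u) * (v' - v)) +
      sg * (f u * g v * box Q u u' v v' - box M u u' v v').
  have h1 := main 1; have h2 := main (-1); rewrite !eqxx ?orbT/= in h1 h2.
  have {}h1 := h1 isT; have {}h2 := h2 isT; rewrite -/eps ler_norml.
  by apply/andP; split; lra.
move=> sgE.
have sg1 z : sg * z <= `|z|.
  by case/orP: sgE => /eqP ->; rewrite ?mul1r ?mulN1r ?ler_norm// -normrN ler_norm.
pose W (x y : R) : R := K / (a * b) * (f x * g y) + eps * K1 * (x * y) +
  sg * (f u * g v * Q x y - M x y).
pose Wu (x y : R) : R := K / (a * b) * (a * f x * g y) + eps * K1 * y +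
  sg * (f u * g v * - kap1 (y - x) - f x * g y * (a * m (y - x) - m1 (y - x))).
pose Wvu (x y : R) : R := K * (f x * g y) + eps * K1 +
  sg * (f u * g v * k (y - x) -
    f x * g y * (a * b * m (y - x) + (a - b) * m1 (y - x) - m2 (y - x))).
have -> : K / (a * b) * box (fun x y => f x * g y) u u' v v' +
      eps * K1 * ((u' - u) * (v' - v)) +
      sg * (f u * g v * box Q u u' v v' - box M u u' v v') = box W u u' v v'.
  by rewrite /box /W; ring.
have ab0 : a * b != 0 by rewrite mulf_neq0// gt_eqF.
have dW (x y : R) : u <= x <= u' -> v <= y <= v' -> is_derive x 1 (W ^~ y) (Wu x y).
  move=> /andP[ux xu'] /andP[vy yv']; have r0 : 0 < y - x by lra.
  have hM : is_derive x 1 (fun x => f x * g y * m (y - x))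
      (f x * g y * (a * m (y - x) - m1 (y - x))).
    have h := deriveM_fun (deriveM_fun (df x) (derive_cst_fun (g y) x))
      (derive_comp_subr (dm r0)).
    by apply: (is_derive_eq h); ring.
  have hQ := deriveZ_fun (f u * g v) (derive_comp_subr (dkap r0)).
  have hd := deriveZ_fun sg (deriveD_fun hQ (deriveZ_fun (-1) hM)).
  have hf := deriveZ_fun (K / (a * b)) (deriveM_fun (df x) (derive_cst_fun (g y) x)).
  have hi := deriveZ_fun (eps * K1) (deriveM_fun (is_derive_id x 1) (derive_cst_fun y x)).
  have h := deriveD_fun (deriveD_fun hf hi) hd.
  have e : W ^~ y = (fun x => K / (a * b) * (f x * g y) + eps * K1 * (id x * y) +
      sg * (f u * g v * kap (y - x) + -1 * (f x * g y * m (y - x)))).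
    by apply/funext => z; rewrite /W /Q /M mulN1r.
  by rewrite e; apply: (is_derive_eq h); rewrite /Wu /=; ring.
have dWu (x y : R) : u <= x <= u' -> v <= y <= v' -> is_derive y 1 (Wu x) (Wvu x y).
  move=> /andP[ux xu'] /andP[vy yv']; have r0 : 0 < y - x by lra.
  have hm := deriveD_fun (deriveZ_fun a (derive_comp_subl (dm r0)))
    (deriveZ_fun (-1) (derive_comp_subl (dm1 r0))).
  have hM := deriveM_fun (deriveZ_fun (f x) (dg y)) hm.
  have hQ := deriveZ_fun (- (f u * g v)) (derive_comp_subl (dkap1 r0)).
  have hd := deriveZ_fun sg (deriveD_fun hQ (deriveZ_fun (-1) hM)).
  have hf := deriveZ_fun (K / (a * b) * (a * f x)) (dg y).
  have hi := deriveZ_fun (eps * K1) (is_derive_id y 1).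
  have h := deriveD_fun (deriveD_fun hf hi) hd.
  have e : Wu x = (fun y => K / (a * b) * (a * f x) * g y + eps * K1 * id y +
      sg * (- (f u * g v) * kap1 (y - x) +
       -1 * (f x * g y * (a * m (y - x) + -1 * m1 (y - x))))).
    by apply/funext => z; rewrite /Wu; ring.
  rewrite e; apply: (is_derive_eq h); rewrite /Wvu.
  have -> : K / (a * b) * (a * f x) * (b * g y) = K * (f x * g y).
    have aE : a * a^-1 = 1 by rewrite divff// gt_eqF.
    have bE : b * b^-1 = 1 by rewrite divff// gt_eqF.
    rewrite invfM (_ : _ * (b * g y) = K * (f x * g y) * ((a * a^-1) * (b * b^-1))); last by ring.
    by rewrite aE bE !mulr1.
  by ring.
apply: (box_ge0 uu vv dW dWu) => x y /andP[ux xu'] /andP[vy yv'].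
  have r0 : y0 - t1 <= y - x by lra.
  have h1 := km r0; have h2 := kK1 r0; rewrite /Wvu.
  set E := a * b * m _ + _ - _ in h1 *.
  have fx0 : 0 <= f x by exact: expR_ge0.
  have gy0 : 0 <= g y by exact: expR_ge0.
  have fx1 : f x <= 1 by rewrite -expR0 ler_expR; nra.
  have gv1 : g v <= 1 by rewrite -expR0 ler_expR; nra.
  have gv0 : 0 <= g v by exact: expR_ge0.
  have xt : x <= t1 by lra.
  have yt : y <= t2 by lra.
  have /andP[l1 l2] := expR_lip a0 ux xt.
  have /andP[l3 l4] := expR_lip b0 vy yt.
  rewrite -/(f u) -/(f x) -/(g v) -/(g y) in l1 l2 l3 l4.
  have d1 : 0 <= f x * g y - f u * g v by nra.
  have fgE : f x * g y - f u * g v <= eps.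
    rewrite (_ : _ - _ = f x * (g y - g v) + (f x - f u) * g v); last by ring.
    have q1 : f x * (g y - g v) <= b * (y - v).
      by apply: le_trans l4; rewrite ler_piMl.
    have q2 : (f x - f u) * g v <= a * (x - u).
      by apply: le_trans l2; rewrite ler_piMr.
    have q3 : b * (y - v) <= b * (v' - v) by apply: ler_wpM2l; [exact: ltW|lra].
    have q4 : a * (x - u) <= a * (u' - u) by apply: ler_wpM2l; [exact: ltW|lra].
    by rewrite /eps; lra.
  rewrite (_ : f u * g v * k (y - x) - f x * g y * E =
    - (f x * g y * (E - k (y - x)) + (f x * g y - f u * g v) * k (y - x))); last by ring.
  have hs := sg1 (f x * g y * (E - k (y - x)) + (f x * g y - f u * g v) * k (y - x)).
  have hn := ler_normD (f x * g y * (E - k (y - x))) ((f x * g y - f u * g v) * k (y - x)).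
  have hn1 : `|f x * g y * (E - k (y - x))| <= K * (f x * g y).
    by rewrite normrM ger0_norm ?mulr_ge0// mulrC ler_wpM2r// mulr_ge0.
  have hn2 : `|(f x * g y - f u * g v) * k (y - x)| <= eps * K1.
    by rewrite normrM ger0_norm//; apply: ler_pM.
  by rewrite mulrN; lra.
Qed.

Lemma usum2_le n p :
  `|\sum_(i < n.+1) \sum_(j < p.+1)
      f (unode x0 t1 n.+1 i) * g (unode y0 t2 p.+1 j) *
      box Q (unode x0 t1 n.+1 i) (unode x0 t1 n.+1 i.+1)
            (unode y0 t2 p.+1 j) (unode y0 t2 p.+1 j.+1) - box M x0 t1 y0 t2| <=
  K / (a * b) +
  (a * ((t1 - x0) / n.+1%:R) + b * ((t2 - y0) / p.+1%:R)) * K1 *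
    ((t1 - x0) * (t2 - y0)).
Proof.
have A0 := a0; have B0 := b0; have X1 := x0t1; have Y2 := y0t2.
pose x := unode x0 t1 n.+1; pose y := unode y0 t2 p.+1.
have tel W : box W x0 t1 y0 t2 =
    \sum_(i < n.+1) \sum_(j < p.+1) box W (x i) (x i.+1) (y j) (y j.+1).
  by rewrite box_telescope /x /y !unode0 !unode_last.
have xmm q r := @unode_le _ x0 t1 n.+1 q r (ltW x0t1).
have ymm q r := @unode_le _ y0 t2 p.+1 q r (ltW y0t2).
rewrite (tel M) -sumrB; under eq_bigr do rewrite -sumrB.
have cell (i : 'I_n.+1) (j : 'I_p.+1) := @cell_le (x i) (x i.+1) (y j) (y j.+1).
apply: (@le_trans _ _ (\sum_(i < n.+1) \sum_(j < p.+1)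
    (K / (a * b) * box (fun x y => f x * g y) (x i) (x i.+1) (y j) (y j.+1) +
  (a * ((t1 - x0) / n.+1%:R) + b * ((t2 - y0) / p.+1%:R)) * K1 *
   box (fun x y => x * y) (x i) (x i.+1) (y j) (y j.+1)))).
  apply: le_trans (ler_norm_sum _ _ _) _; apply: ler_sum => i _.
  apply: le_trans (ler_norm_sum _ _ _) _; apply: ler_sum => j _.
  have h : box (fun x y => x * y) (x i) (x i.+1) (y j) (y j.+1) =
    (x i.+1 - x i) * (y j.+1 - y j) by rewrite /box; ring.
  rewrite h -{1}(unodeS x0 t1 n.+1 i) -{1}(unodeS y0 t2 p.+1 j).
  apply: cell; [|exact: xmm| | |exact: ymm|].
  - have h0 := unode0 x0 t1 n.+1; rewrite -/(x 0%N) in h0; rewrite -h0; exact: xmm.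
  - have h0 := unode_last x0 t1 n; rewrite -/(x n.+1) in h0; rewrite -h0; exact: xmm.
  - have h0 := unode0 y0 t2 p.+1; rewrite -/(y 0%N) in h0; rewrite -h0; exact: ymm.
  - have h0 := unode_last y0 t2 p; rewrite -/(y p.+1) in h0; rewrite -h0; exact: ymm.
under eq_bigr do rewrite big_split/= -!mulr_sumr.
rewrite big_split/= -!mulr_sumr -!tel; apply: lerD; last first.
  by rewrite /box le_eqVlt; apply/orP; left; apply/eqP; ring.
rewrite -[leRHS]mulr1; apply: ler_wpM2l; first by rewrite divr_ge0// mulr_ge0// ltW.
rewrite (_ : box _ _ _ _ _ = (f t1 - f x0) * (g t2 - g y0)); last by rewrite /box; ring.
have f1 : f t1 = 1 by rewrite /f subrr mulr0 expR0.
have g1 : g t2 = 1 by rewrite /g subrr mulr0 expR0.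
have p1 := expR_ge0 (- a * (t1 - x0)); have p2 := expR_ge0 (- b * (t2 - y0)).
have q1 : f x0 <= 1 by rewrite -expR0 ler_expR; nra.
have q2 : g y0 <= 1 by rewrite -expR0 ler_expR; nra.
by rewrite f1 g1; apply: mulr_ile1; rewrite /f /g in q1 q2 *; lra.
Qed.
End Rectangle.

(** * Expansion of the power kernel *)

Section Kernel.
Context (R : realType).
Variables (c0 p a b : R).
Hypotheses (a0 : 0 < a) (b0 : 0 < b) (p0 : p < 0).

(** The coefficient of the n-th derivative of c0 r^p. *)
Definition dpow (n : nat) : R := c0 * \prod_(0 <= i < n) (p - i%:R).

Definition kern (n : nat) (r : R) : R := dpow n * r `^ (p - n%:R).

Lemma kern_derive n (r : R) : 0 < r -> is_derive r 1 (kern n) (kern n.+1 r).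
Proof.
move=> r0; have h := deriveZ_fun (dpow n) (is_derive1_powR (p - n%:R) r0).
apply: (is_derive_eq h); rewrite /kern /dpow big_nat_recr//= !mulrA.
by rewrite -natr1 opprD !addrA.
Qed.

Lemma powR_le_neg (r s q : R) : 0 < s -> s <= r -> q <= 0 -> r `^ q <= s `^ q.
Proof.
move=> s0 sr q0; have r0 : 0 < r by exact: lt_le_trans sr.
rewrite -[q]opprK !(powRN _ (- q)) lef_pV2 ?posrE ?powR_gt0//.
by apply: ge0_ler_powR; rewrite ?nnegrE ?oppr_ge0// ltW.
Qed.

Lemma kern_le n (r s : R) : 0 < s -> s <= r ->
  `|kern n r| <= `|dpow n| * s `^ (p - n%:R).
Proof.
move=> s0 sr; rewrite normrM (ger0_norm (powR_ge0 _ _)) ler_wpM2l//.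
by apply: powR_le_neg => //; have := p0; have := ler0n R n; lra.
Qed.

Definition ecoef (n : nat) : R := ((-1) ^+ n / b ^+ n.+1 + 1 / a ^+ n.+1) / (a + b).

(** The j-th derivative of the truncated expansion. *)
Definition expansion (N : nat) (j : nat) (r : R) : R :=
  \sum_(0 <= n < N.+1) ecoef n * kern (n + j) r.

Lemma expansion_derive N j (r : R) : 0 < r ->
  is_derive r 1 (expansion N j) (expansion N j.+1 r).
Proof.
move=> r0; rewrite /expansion; elim: N => [|N IH].
  rewrite big_nat1; have -> : (fun r => \sum_(0 <= n < 1) ecoef n * kern (n + j) r) =
    (fun r => ecoef 0 * kern j r) by apply/funext => z; rewrite big_nat1.
  exact: (deriveZ_fun _ (kern_derive _ r0)).
rewrite big_nat_recr//=.
have -> : (fun r => \sum_(0 <= n < N.+2) ecoef n * kern (n + j) r) =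
  (fun r => \sum_(0 <= n < N.+1) ecoef n * kern (n + j) r + ecoef N.+1 * kern (N.+1 + j) r).
  by apply/funext => z; rewrite big_nat_recr.
rewrite addnS; exact: (deriveD_fun IH (deriveZ_fun _ (kern_derive _ r0))).
Qed.

Lemma ecoef_rec n : a * b * ecoef n.+2 = ecoef n - (a - b) * ecoef n.+1.
Proof.
have ab : a + b != 0 by rewrite gt_eqF// addr_gt0.
rewrite /ecoef !exprS; field.
by rewrite ab !expf_neq0 ?gt_eqF.
Qed.

Lemma ecoef01 : a * b * ecoef 0 = 1 /\ a * b * ecoef 1 + (a - b) * ecoef 0 = 0.
Proof.
have ab : a + b != 0 by rewrite gt_eqF// addr_gt0.
by split; rewrite /ecoef !exprS !expr0; field; rewrite ab !gt_eqF.
Qed.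

(** The coefficients are those of the power series of 1/((a - D)(b + D)) in the
    derivation D, so that the truncated series inverts (a - D)(b + D) on the
    kernel up to two terms of higher order. *)
Lemma expansion_residual N (r : R) :
  a * b * expansion N 0 r + (a - b) * expansion N 1 r - expansion N 2 r - kern 0 r =
  - (a * b * ecoef N.+1 * kern N.+1 r + ecoef N * kern N.+2 r).
Proof.
rewrite /expansion; elim: N => [|N IH].
  rewrite !big_nat1 !add0n; have [h0 h1] := ecoef01.
  transitivity ((a * b * ecoef 0) * kern 0 r + ((a - b) * ecoef 0) * kern 1 r -
    ecoef 0 * kern 2 r - kern 0 r); first by ring.
  rewrite h0; have -> : (a - b) * ecoef 0 = - (a * b * ecoef 1) by rewrite -[RHS]add0r -h1; ring.
  by ring.
rewrite !(@big_nat_recr _ _ _ N.+1 0)//= !addn0 !addnS !addn0.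
have := ecoef_rec N; move: IH.
move: (\sum_(_ <= _ < _) _) (\sum_(_ <= _ < _) _) (\sum_(_ <= _ < _) _) => z y x IH h.
have -> : a * b * (x + ecoef N.+1 * kern N.+1 r) +
  (a - b) * (y + ecoef N.+1 * kern N.+2 r) - (z + ecoef N.+1 * kern N.+3 r) - kern 0 r =
  (a * b * x + (a - b) * y - z - kern 0 r) + (a * b * ecoef N.+1 * kern N.+1 r +
  (a - b) * ecoef N.+1 * kern N.+2 r - ecoef N.+1 * kern N.+3 r) by ring.
by rewrite IH h; ring.
Qed.

Lemma powR_half (s q : R) : 0 < s -> (s / 2) `^ q = (2^-1) `^ q * s `^ q.
Proof. by move=> s0; rewrite mulrC powRM// ltW. Qed.

(** All exponents p - n are negative, so the bounds at r >= s/2 follow from those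
    at s/2 and, for the expansion itself, from those at 1 <= s/2. *)
Lemma expansion_bounds N : exists2 C : R, 0 <= C & forall s r : R, 2 <= s -> s / 2 <= r ->
  `|a * b * expansion N 0 r + (a - b) * expansion N 1 r - expansion N 2 r - kern 0 r|
    <= C * s `^ (p - N.+1%:R) /\ `|expansion N 0 r| <= C.
Proof.
pose C1 := `|a * b * ecoef N.+1| * (`|dpow N.+1| * (2^-1) `^ (p - N.+1%:R)) +
  `|ecoef N| * (`|dpow N.+2| * (2^-1) `^ (p - N.+2%:R)).
pose C2 := \sum_(0 <= n < N.+1) `|ecoef n| * `|dpow n|.
have C10 : 0 <= C1 by rewrite addr_ge0// !mulr_ge0// powR_ge0.
have C20 : 0 <= C2 by apply: sumr_ge0 => i _; rewrite mulr_ge0.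
exists (C1 + C2) => [|s r s2 sr]; first exact: addr_ge0.
have s0 : 0 < s / 2 by lra.
have s0' : 0 < s by lra.
split.
  rewrite expansion_residual normrN.
  apply: (@le_trans _ _ (C1 * s `^ (p - N.+1%:R))); last first.
    by rewrite ler_wpM2r ?powR_ge0// lerDl.
  rewrite /C1 mulrDl; apply: le_trans (ler_normD _ _) _; apply: lerD.
    rewrite normrM -[leRHS]mulrA ler_wpM2l// -[leRHS]mulrA.
    by apply: le_trans (kern_le _ s0 sr) _; rewrite powR_half.
  rewrite normrM -[leRHS]mulrA ler_wpM2l// -[leRHS]mulrA.
  apply: le_trans (kern_le _ s0 sr) _; rewrite powR_half//.
  rewrite ler_wpM2l// ler_wpM2l ?powR_ge0//.
  by apply: ler_powR; rewrite -?(natr1 _ N.+1); lra.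
apply: (@le_trans _ _ C2); last by rewrite lerDr.
apply: le_trans (ler_norm_sum _ _ _) _; apply: ler_sum => n _.
rewrite normrM ler_wpM2l// addn0.
have r1 : 1 <= r by lra.
by apply: le_trans (kern_le _ ltr01 r1) _; rewrite powR1 mulr1.
Qed.
End Kernel.

Section KernelRectangle.
Context (R : realType).
Variables (c0 p a b : R) (kap kap1 : R -> R).
Hypotheses (a0 : 0 < a) (b0 : 0 < b) (p0 : p < 0).
Hypothesis dkap : forall r : R, 0 < r -> is_derive r 1 kap (kap1 r).
Hypothesis dkap1 : forall r : R, 0 < r -> is_derive r 1 kap1 (- kern c0 p 0 r).

(** The constant [C] is uniform in [t] and [s].  The constant [C'] is not, but it
    comes with the meshes of the partitions, which vanish for fixed [t] and [s]. *)
Lemma kernel_sum_le N : exists2 C : R, 0 <= C & forall t s : R, 2 <= s ->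
  exists C' : R, forall n q : nat,
  `|\sum_(i < n.+1) \sum_(j < q.+1)
      expR (- a * (t - unode (t - s / 2) t n.+1 i)) *
      expR (- b * (t + s - unode (t + s / 2) (t + s) q.+1 j)) *
      box (fun u v => kap (v - u))
        (unode (t - s / 2) t n.+1 i) (unode (t - s / 2) t n.+1 i.+1)
        (unode (t + s / 2) (t + s) q.+1 j) (unode (t + s / 2) (t + s) q.+1 j.+1) -
    expansion c0 p a b N 0 s| <=
  C * (s `^ (p - N.+1%:R) + expR (- a * (s / 2)) + expR (- b * (s / 2))) +
  C' * (n.+1%:R^-1 + q.+1%:R^-1).
Proof.
have [C C0 hC] := expansion_bounds c0 a0 b0 p0 N.
have ab0 : 0 < a * b by exact: mulr_gt0.
exists (C / (a * b) + 2 * C) => [|t s s2].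
  by apply: addr_ge0; [apply: divr_ge0 => //; exact: ltW|exact: mulr_ge0].
have s0 : 0 < s by lra.
pose K := C * s `^ (p - N.+1%:R); pose K1 := `|dpow c0 p 0| * (s / 2) `^ (p - 0%:R).
have K0 : 0 <= K by rewrite mulr_ge0// powR_ge0.
have K10 : 0 <= K1 by rewrite mulr_ge0// powR_ge0.
have l1 : t - s / 2 < t by lra.
have l2 : t < t + s / 2 by lra.
have l3 : t + s / 2 < t + s by lra.
have e1 : t + s / 2 - t = s / 2 by ring.
have km (r : R) : t + s / 2 - t <= r -> `|a * b * expansion c0 p a b N 0 r +
   (a - b) * expansion c0 p a b N 1 r - expansion c0 p a b N 2 r - kern c0 p 0 r| <= K.
  by rewrite e1 => hr; exact: (hC s r s2 hr).1.
have kK1 (r : R) : t + s / 2 - t <= r -> `|kern c0 p 0 r| <= K1.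
  by rewrite e1 => hr; apply: kern_le => //; lra.
exists ((a + b) * (s / 2) * K1 * (s / 2 * (s / 2))) => n q.
have h := usum2_le a0 b0 K0 l1 l2 l3 dkap dkap1
  (fun r => @expansion_derive _ c0 p a b N 0 r)
  (fun r => @expansion_derive _ c0 p a b N 1 r) km kK1 n q.
move: h; set S := \sum_(i < n.+1) _; set B := box _ _ _ _ _ => h.
have hB : `|B - expansion c0 p a b N 0 s| <=
    2 * C * (expR (- a * (s / 2)) + expR (- b * (s / 2))).
  rewrite /B /box.
  rewrite !subrr !mulr0 !expR0 !mul1r.
  have -> : t + s - t = s by ring.
  have -> : t + s / 2 - t = s / 2 by ring.
  have -> : t + s - (t + s / 2) = s / 2 by field.
  have -> : t - (t - s / 2) = s / 2 by ring.
  have -> : t + s - (t - s / 2) = s + s / 2 by ring.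
  have -> : t + s / 2 - (t - s / 2) = s by field.
  rewrite mulr1.
  have m1 := (hC s (s / 2) s2 (lexx _)).2.
  have m2 : `|expansion c0 p a b N 0 s| <= C by apply: (hC s s s2 _).2; lra.
  have m3 : `|expansion c0 p a b N 0 (s + s / 2)| <= C by apply: (hC s _ s2 _).2; lra.
  have x0 := expR_ge0 (- a * (s / 2)); have y0 := expR_ge0 (- b * (s / 2)).
  have y1 : expR (- b * (s / 2)) <= 1.
    by rewrite -[leRHS]expR0 ler_expR mulNr oppr_le0; apply: mulr_ge0; [exact: ltW|lra].
  move: (expansion _ _ _ _ _ _ (s / 2)) (expansion _ _ _ _ _ _ (s + s / 2)) m1 m3 => u v m1 m3.
  move: (expansion _ _ _ _ _ _ s) m2 => w m2.
  move: (expR (- a * (s / 2))) (expR (- b * (s / 2))) x0 y0 y1 => x y x0 y0 y1.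
  have -> : w - y * u - (x * v - x * y * w) - w = x * (y * w) - x * v - y * u by ring.
  have n1 : `|x * (y * w)| <= x * C.
    rewrite normrM ger0_norm// ler_wpM2l// normrM ger0_norm//.
    by rewrite (le_trans _ m2)// ler_piMl.
  have n2 : `|x * v| <= x * C by rewrite normrM ger0_norm// ler_wpM2l.
  have n3 : `|y * u| <= y * C by rewrite normrM ger0_norm// ler_wpM2l.
  have := ler_normB (x * (y * w) - x * v) (y * u).
  have := ler_normB (x * (y * w)) (x * v).
  have : 0 <= y * C by rewrite mulr_ge0.
  by lra.
have tri : `|S - expansion c0 p a b N 0 s| <= `|S - B| + `|B - expansion c0 p a b N 0 s|.
  by apply: le_trans (ler_normD _ _); rewrite addrA subrK.
apply: (le_trans tri).
have -> : (a + b) * (s / 2) * K1 * (s / 2 * (s / 2)) * (n.+1%:R^-1 + q.+1%:R^-1) =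
  (a * (s / 2 / n.+1%:R) + b * (s / 2 / q.+1%:R)) * K1 * (s / 2 * (s / 2)) +
  (a * (s / 2 / q.+1%:R) + b * (s / 2 / n.+1%:R)) * K1 * (s / 2 * (s / 2)) by ring.
have e2 : t - (t - s / 2) = s / 2 by ring.
have e3 : t + s - (t + s / 2) = s / 2 by field.
rewrite e2 e3 in h.
have rest : 0 <= (a * (s / 2 / q.+1%:R) + b * (s / 2 / n.+1%:R)) * K1 * (s / 2 * (s / 2)).
  have s20 : 0 <= s / 2 by lra.
  have [a0' b0'] := (ltW a0, ltW b0).
  apply: mulr_ge0; last exact: mulr_ge0.
  by apply: mulr_ge0 => //; apply: addr_ge0; apply: mulr_ge0 => //; apply: divr_ge0.
have KE : K / (a * b) = C / (a * b) * s `^ (p - N.+1%:R) by rewrite /K mulrAC.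
have x0 := expR_ge0 (- a * (s / 2)); have y0 := expR_ge0 (- b * (s / 2)).
have z0 := powR_ge0 s (p - N.+1%:R).
rewrite KE in h.
have D0 : 0 <= C / (a * b) by apply: divr_ge0 => //; exact: ltW.
move: (C / (a * b)) (s `^ (p - N.+1%:R)) (expR (- a * (s / 2)))
  (expR (- b * (s / 2))) D0 x0 y0 z0 h hB => D z x y D0 x0 y0 z0 h hB.
have d1 : 0 <= D * x by exact: mulr_ge0.
have d2 : 0 <= D * y by exact: mulr_ge0.
have d3 : 0 <= C * z by exact: mulr_ge0.
move: h rest; set E := (a * (s / 2 / n.+1%:R) + b * _) * K1 * _.
set F := (a * (s / 2 / q.+1%:R) + b * _) * K1 * _.
move: E F (`|S - B|) (`|B - _|) hB => E F X Y hB h rest.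
rewrite !mulrDl !mulrDr; move: h hB rest d1 d2 d3; clear; rewrite mulrDr.
move: (D * x) (D * y) (D * z) => Dx Dy Dz; rewrite -!mulrA.
by move: (C * x) (C * y) (C * z) => Cx Cy Cz; lra.
Qed.
End KernelRectangle.

(** * Riemann-Stieltjes sums against a fractional Brownian motion *)

Section fBmSums.
Context (disp : measure_display) (T : measurableType disp) (R : realType).
Variable P : probability T R.

Local Notation L2 := (Lfun P 2%:E).

Lemma covariance_centered (X Y : T -> R) :
  expectation P X = 0%E -> expectation P Y = 0%E ->
  covariance P X Y = expectation P (X \* Y).
Proof.
move=> X0 Y0; rewrite covariance.unlock X0 Y0.
have e (Z : T -> R) : Z \- cst (fine 0%E) = Z.
  by apply/funext => w /=; rewrite subr0.
by rewrite !e.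
Qed.

(** The covariance of [X] with itself is its second moment, so that its
    finiteness is square integrability. *)
Lemma centered_L2 (X : T -> R) : measurable_fun setT X ->
  expectation P X = 0%E -> covariance P X X \is a fin_num -> X \in L2.
Proof.
move=> mX X0; rewrite covariance_centered// unlock => h.
apply: L2P => //; rewrite -ge0_fin_numE//.
by apply: integral_ge0 => w _; rewrite lee_fin sqr_ge0.
Qed.

Lemma abel_sum (f c : nat -> R) n :
  \sum_(k < n) f k * (c k.+1 - c k) =
  f n * c n - f 0%N * c 0%N - \sum_(k < n) (f k.+1 - f k) * c k.+1.
Proof.
elim: n => [|n IH]; first by rewrite !big_ord0; ring.
by rewrite !big_ord_recr/= IH; ring.
Qed.

Lemma L2_incr (X : R -> T -> R) u v : (forall u, X u \in L2) ->
  (fun w => X v w - X u w) \in L2.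
Proof.
move=> hX; rewrite (_ : (fun w => _) = X v \+ (fun w => -1 * X u w)).
  by rewrite L2D ?L2Z.
by apply/funext => w; rewrite /= mulN1r.
Qed.

Lemma usum_L2 (f : R -> R) (X : R -> T -> R) a b n : (forall u, X u \in L2) ->
  (fun w => usum f (X ^~ w) a b n) \in L2.
Proof.
move=> hX.
exact: (L2_sum _ (fun k : 'I_n => L2_incr (unode a b n k) (unode a b n k.+1) hX)).
Qed.

Lemma L2dot_incr (X Y : R -> T -> R) u u' v v' :
  (forall u, X u \in L2) -> (forall u, Y u \in L2) ->
  L2dot P (fun w => X u' w - X u w) (fun w => Y v' w - Y v w) =
  box (fun u v => L2dot P (X u) (Y v)) u u' v v'.
Proof.
move=> hX hY.
have e (Z : R -> T -> R) x y :
    (fun w => Z y w - Z x w) = Z y \+ (fun w => -1 * Z x w).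
  by apply/funext => w /=; rewrite mulN1r.
by rewrite !e !(L2dotDl, L2dotDr, L2dotZl, L2dotZr) ?L2D ?L2Z// /box; ring.
Qed.

Lemma L2dot_usum (f g : R -> R) (X Y : R -> T -> R) a b c d n m :
  (forall u, X u \in L2) -> (forall u, Y u \in L2) ->
  L2dot P (fun w => usum f (X ^~ w) a b n) (fun w => usum g (Y ^~ w) c d m) =
  \sum_(i < n) \sum_(j < m) f (unode a b n i) * g (unode c d m j) *
    box (fun u v => L2dot P (X u) (Y v))
      (unode a b n i) (unode a b n i.+1) (unode c d m j) (unode c d m j.+1).
Proof.
move=> hX hY; have hg := usum_L2 g c d m hY.
rewrite (L2dot_suml _ (fun k : 'I_n => L2_incr (unode a b n k) (unode a b n k.+1) hX))//.
apply: eq_bigr => i _.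
rewrite (L2dot_sumr _ (fun k : 'I_m => L2_incr (unode c d m k) (unode c d m k.+1) hY))//;
  last exact: L2_incr.
rewrite mulr_sumr; apply: eq_bigr => j _.
by rewrite L2dot_incr// mulrA.
Qed.

Variables (H : R) (X : R -> T -> R).
Hypotheses (H01 : 0 < H < 1) (mX : forall u, measurable_fun setT (X u)).
Hypothesis fX : is_fBm P H X.

Lemma fBm_L2 u : X u \in L2.
Proof.
have [_ cX [s s0 sX]] := fX; apply: centered_L2; [exact: mX|exact: cX|].
by rewrite sX.
Qed.

Lemma fBm_incr_L2le : exists2 s : R, 0 <= s &
  forall u v, L2le P (fun w => X u w - X v w) (s * `|u - v| `^ H).
Proof.
have [_ cX [s s0 sX]] := fX; have H0 : 0 < H by case/andP: H01.
exists s => [|u v]; first exact: ltW.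
have hX := fBm_L2; split; first exact: L2_incr.
have hd x y : L2dot P (X x) (X y) =
    s ^+ 2 / 2 * (`|x| `^ (2 * H) + `|y| `^ (2 * H) - `|x - y| `^ (2 * H)).
  apply: EFin_inj; rewrite -L2dotE// -covariance_centered ?cX//.
have z0 : `|0 : R| `^ (2 * H) = 0 by rewrite normr0 powR0// mulf_neq0 ?gt_eqF.
have hp : `|u - v| `^ (2 * H) = (`|u - v| `^ H) ^+ 2.
  by rewrite mulrC powRrM -powR_mulrn ?powR_ge0.
rewrite L2dot_incr// /box !hd !subrr z0 (distrC v u) hp exprMn.
by rewrite le_eqVlt; apply/orP; left; apply/eqP; field.
Qed.

(** Summation by parts puts the increments on the exponential f, and
    |B_u - B_b| <= K f(u)^(-1/2) in L2.  The resulting sum is of the type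
    int df / sqrt f, which is bounded whatever the length of the interval. *)
Lemma fBm_usum_L2le (al : R) : 0 < al -> exists2 C : R, 0 <= C &
  forall a b n, a < b ->
    L2le P (fun w => usum (fun u => expR (- al * (b - u))) (X ^~ w) a b n.+1) C.
Proof.
move=> al0; have [s s0 hs] := fBm_incr_L2le; have hX := fBm_L2.
have al2 : 0 <= al / 2 by rewrite divr_ge0// ltW.
pose K := s * (1 + 2 / al).
have K0 : 0 <= K by rewrite mulr_ge0// addr_ge0// divr_ge0// ltW.
exists (2 * K) => [|a b n ab]; first exact: mulr_ge0.
pose x := unode a b n.+1.
pose h k := expR (- (al / 2) * (b - x k)).
have h0 k : 0 < h k by exact: expR_gt0.
(* h is the square root of the weight. *)
have fE k : expR (- al * (b - x k)) = h k ^+ 2.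
  by rewrite /h -expRM_natl; congr expR; field.
have xmm q r : (q <= r)%N -> x q <= x r := @unode_le _ a b n.+1 q r (ltW ab).
have xb : x n.+1 = b by exact: unode_last.
have hm k : h k <= h k.+1.
  by rewrite /h ler_expR !mulNr lerN2 ler_wpM2l// lerB// xmm.
have hK k : (k <= n.+1)%N -> L2le P (fun w => X (x k) w - X b w) (K / h k).
  move=> kn; apply: L2le_weaken (hs (x k) b).
    by rewrite mulr_ge0// powR_ge0.
  rewrite /K -mulrA ler_wpM2l// /h -expRN mulNr opprK.
  have xkb : 0 <= b - x k by rewrite subr_ge0 -xb; exact: xmm.
  rewrite distrC ger0_norm//; move: (b - x k) xkb => y y0.
  have yH : y `^ H <= 1 + y.
    have [H0 H1] := andP H01.
    have [y1|y1] := leP y 1.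
      have := @ge0_ler_powR _ H (ltW H0) y 1; rewrite !nnegrE powR1 => /(_ y0 ler01 y1).
      by lra.
    by have := ler1_powR (ltW y1) (ltW H1); lra.
  have e1 := expR_ge1Dx (al / 2 * y).
  have e2 : 1 <= expR (al / 2 * y) by rewrite -[leLHS]expR0 ler_expR mulr_ge0.
  have e3 : y <= 2 / al * expR (al / 2 * y).
    have hp : 0 < 2 / al by rewrite divr_gt0.
    have : 2 / al * (1 + al / 2 * y) <= 2 / al * expR (al / 2 * y) by rewrite ler_pM2l.
    have -> : 2 / al * (1 + al / 2 * y) = 2 / al + y by field; rewrite gt_eqF.
    by lra.
  by rewrite mulrDl mul1r; lra.
have SE : (fun w => usum (fun u => expR (- al * (b - u))) (X ^~ w) a b n.+1) =
  (fun w => \sum_(k < n.+1) (- (h k.+1 ^+ 2 - h k ^+ 2)) * (X (x k.+1) w - X b w)) \+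
  (fun w => - h 0%N ^+ 2 * (X (x 0%N) w - X b w)).
  apply/funext => w /=; rewrite /usum.
  transitivity (\sum_(k < n.+1) h k ^+ 2 * ((X (x k.+1) w - X b w) - (X (x k) w - X b w))).
    by apply: eq_bigr => k _; rewrite -/(x k) -/(x k.+1) fE; congr (_ * _); ring.
  rewrite (abel_sum (fun k => h k ^+ 2) (fun k => X (x k) w - X b w)).
  rewrite xb subrr mulr0 sub0r addrC mulNr; congr (_ + _).
  by rewrite -sumrN; apply: eq_bigr => k _; rewrite mulNr.
rewrite SE.
have hsum := L2le_sum (fun k : 'I_n.+1 => - (h k.+1 ^+ 2 - h k ^+ 2))
  (a := fun k : 'I_n.+1 => K / h k.+1) (X := fun (k : 'I_n.+1) w => X (x k.+1) w - X b w)
  (fun k => divr_ge0 K0 (ltW (h0 _))) (fun k => hK k.+1 (ltn_ord k)).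
have bsum : \sum_(k < n.+1) `|- (h k.+1 ^+ 2 - h k ^+ 2)| * (K / h k.+1) <=
    2 * K * (h n.+1 - h 0%N).
  rewrite -(@telescope_sumr _ 0 n.+1 h)// big_mkord mulr_sumr; apply: ler_sum => k _.
  rewrite normrN ger0_norm; last by rewrite subr_ge0 ler_pXn2r ?nnegrE// ltW.
  rewrite mulrA ler_pdivrMr//.
  have := h0 k; have := h0 k.+1; have := hm k; move: (h k) (h k.+1) => p q pq q0 p0.
  rewrite -subr_ge0.
  have -> : 2 * K * (q - p) * q - (q ^+ 2 - p ^+ 2) * K = K * (q - p) ^+ 2 by ring.
  by rewrite mulr_ge0// sqr_ge0.
have S0 : 0 <= \sum_(k < n.+1) `|- (h k.+1 ^+ 2 - h k ^+ 2)| * (K / h k.+1).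
  by apply: sumr_ge0 => k _; rewrite mulr_ge0// divr_ge0// ltW.
have hz := L2leZ (- h 0%N ^+ 2) (hK 0%N (leq0n _)).
apply: L2le_weaken (L2leD _ _ hsum hz) => //.
- by rewrite addr_ge0// mulr_ge0// divr_ge0// ltW.
- have -> : `|- h 0%N ^+ 2| * (K / h 0%N) = K * h 0%N.
    rewrite normrN ger0_norm ?sqr_ge0//.
    by field; rewrite gt_eqF.
  have hn : h n.+1 = 1 by rewrite /h xb subrr mulr0 expR0.
  have h0' := h0 0%N; have : 0 <= K * h 0%N by rewrite mulr_ge0// ltW.
  by rewrite hn in bsum; move: bsum; lra.
- by rewrite mulr_ge0// divr_ge0// ltW.
Qed.
End fBmSums.

(** * Integrals over half-lines and over compact intervals *)

Section OUProcess.
Context (disp : measure_display) (T : measurableType disp) (R : realType).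
Variable P : probability T R.
Variables (H al nu : R) (X Y : R -> T -> R).
Hypotheses (H01 : 0 < H < 1) (al0 : 0 < al).
Hypotheses (mX : forall u, measurable_fun setT (X u)).
Hypotheses (mY : forall u, measurable_fun setT (Y u)).
Hypothesis fX : is_fBm P H X.
Hypothesis OU : forall t, {ae P, forall w, exists2 l,
  is_RS_integral_ninfty (fun u => expR (- al * (t - u))) (X ^~ w) t l &
  Y t w = nu * l}.

(** The part of [Y b] that is produced by the noise on [a, b].  As a combination
    of two values of [Y] it is measurable, which is not clear for the pathwise
    integrals. *)
Definition innov a b w : R := Y b w - expR (- al * (b - a)) * Y a w.

Definition innov_sum a b n w : R :=
  nu * usum (fun u => expR (- al * (b - u))) (X ^~ w) a b n.+1.

Lemma damping a b u :
  expR (- al * (b - u)) = expR (- al * (b - a)) * expR (- al * (a - u)).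
Proof. by rewrite -expRD; congr expR; ring. Qed.

Lemma innov_measurable a b : measurable_fun setT (innov a b).
Proof. by apply: measurable_funB => //; apply: measurable_funM. Qed.

Lemma innov_cvg a b : a < b ->
  {ae P, forall w, innov_sum a b n w @[n --> \oo] --> innov a b w}.
Proof.
move=> ab; apply: filterS2 (OU a) (OU b) => w [la ha ya] [lb hb yb].
rewrite /innov ya yb (_ : _ - _ = nu * (lb - expR (- al * (b - a)) * la)); last by ring.
by apply: cvgMr; exact: RS_ninfty_split ab (damping a b) hb ha.
Qed.

Lemma innov_sum_L2le : exists2 C : R, 0 <= C & forall a b n, a < b ->
  L2le P (innov_sum a b n) C.
Proof.
have [C C0 hC] := fBm_usum_L2le H01 mX fX al0.
exists (`|nu| * C) => [|a b n ab]; first exact: mulr_ge0.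
by apply: L2leZ; exact: hC.
Qed.

(** By uniqueness of limits the contribution of [t - m - 1, t] is nu J(t - m - 1)
    for the function J in the definition of the improper integral. *)
Lemma OU_cvg t : {ae P, forall w, innov (t - m.+1%:R) t w @[m --> \oo] --> Y t w}.
Proof.
have h : {ae P, forall w, forall m, exists2 l,
    is_RS_integral_ninfty (fun u => expR (- al * (t - m.+1%:R - u))) (X ^~ w) (t - m.+1%:R) l &
    Y (t - m.+1%:R) w = nu * l}.
  by apply/ae_foralln => m; exact: OU.
apply: filterS2 h (OU t) => w h [l [J hJ cJ] yl].
have tm m : t - m.+1%:R < t by rewrite ltrBlDr ltrDl ltr0n.
have e m : innov (t - m.+1%:R) t w = nu * J (t - m.+1%:R).
  have [l' hl' yl'] := h m.
  have c1 := RS_ninfty_split (tm m) (damping _ _) (ex_intro2 _ _ J hJ cJ) hl'.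
  have c2 := RS_usum_cvg (tm m) (hJ _ (ltW (tm m))).
  rewrite /innov yl yl' -(cvgr_uniq _ c1 c2); ring.
rewrite yl (_ : (fun m => _) = (fun m => nu * J (t - m.+1%:R))); last exact/funext.
apply: cvgMr; apply: cvg_comp cJ.
apply/cvgrNyPle => A; near=> m.
have : t - A <= m%:R by near: m; exact: nbhs_infty_ger.
by rewrite -natr1; lra.
Unshelve. all: by end_near. Qed.

Lemma innov_L2le : exists2 C : R, 0 <= C & forall a b, a < b -> L2le P (innov a b) C.
Proof.
have [C C0 hC] := innov_sum_L2le; exists C => // a b ab.
by apply: L2le_lim (innov_cvg ab); [exact: innov_measurable|move=> n; exact: hC].
Qed.

Lemma OU_L2le : exists2 C : R, 0 <= C & forall t, L2le P (Y t) C.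
Proof.
have [C C0 hC] := innov_L2le; exists C => // t.
apply: L2le_lim (OU_cvg t); first exact: mY.
by move=> m; apply: hC; rewrite ltrBlDr ltrDl ltr0n.
Qed.

Lemma innov_centered a b : a < b -> L2dot P (innov a b) (cst 1) = 0.
Proof.
move=> ab; have [C C0 hC] := innov_sum_L2le; have hX := fBm_L2 mX fX.
have h1 : cst 1 \in Lfun P 2%:E by exact: L2_cst.
have c := L2dot_lim C0 (innov_measurable a b) (fun n => hC a b n ab) (innov_cvg ab) h1.
have X1 u : L2dot P (X u) (cst 1) = 0.
  have [_ cX _] := fX; apply: EFin_inj; rewrite -L2dotE//.
  rewrite (_ : X u \* cst 1 = X u) ?cX//.
  by apply/funext => w /=; rewrite mulr1.
suff e : (fun n => L2dot P (innov_sum a b n) (cst 1)) = cst 0.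
  by rewrite e in c; apply: cvgr_uniq c (cvg_cst _).
apply/funext => n; rewrite L2dotZl ?usum_L2//.
rewrite (L2dot_suml _ (fun k : 'I_n.+1 => L2_incr (unode a b n.+1 k) (unode a b n.+1 k.+1) hX))//.
rewrite big1 ?mulr0// => i _.
have e (u v : R) : (fun w => X v w - X u w) = X v \+ (fun w => -1 * X u w).
  by apply/funext => w /=; rewrite mulN1r.
by rewrite e L2dotDl ?L2Z// L2dotZl// !X1 mulr0 addr0 mulr0.
Qed.

(** [Y b] has the same mean as its damped past, the new noise being centered. *)
Lemma OU_mean_le C a b : 0 <= C -> (forall t, L2le P (Y t) C) -> a < b ->
  `|L2dot P (Y b) (cst 1)| <= expR (- al * (b - a)) * C.
Proof.
move=> C0 hC ab; have := innov_centered ab.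
rewrite /innov; have : 0 <= expR (- al * (b - a)) by exact: expR_ge0.
move: (expR (- al * (b - a))) => E E0.
have h1 : cst 1 \in Lfun P 2%:E by exact: L2_cst.
have e : (fun w => Y b w - E * Y a w) = Y b \+ (fun w => - E * Y a w).
  by apply/funext => w; rewrite /= mulNr.
have hY t := (hC t).1.
rewrite e L2dotDl ?L2Z// L2dotZl// mulNr => /eqP; rewrite subr_eq0 => /eqP ->.
rewrite normrM ger0_norm// ler_wpM2l//.
by rewrite -[leRHS]mulr1; apply: L2dot_le => //; exact: L2le_cst1.
Qed.
End OUProcess.

(** * The covariance of two components *)

Lemma double_limit_le (R : realType) (x : nat -> nat -> R) (y : nat -> R)
    (z A K C : R) :
  (forall n m, `|x n m - A| <= K + C * (n.+1%:R^-1 + m.+1%:R^-1)) ->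
  (forall n, x n m @[m --> \oo] --> y n) -> y n @[n --> \oo] --> z ->
  `|z - A| <= K.
Proof.
move=> h cx cy.
have hy n : `|y n - A| <= K + C * n.+1%:R^-1.
  have c1 : `|x n m - A| @[m --> \oo] --> `|y n - A|.
    by apply: cvg_norm; apply: cvgB => //; exact: cvg_cst.
  have c2 : K + C * (n.+1%:R^-1 + harmonic m) @[m --> \oo] --> K + C * (n.+1%:R^-1 + 0).
    apply: cvgD; first exact: cvg_cst.
    by apply: cvgMr; apply: cvgD; [exact: cvg_cst|exact: cvg_harmonic].
  rewrite addr0 in c2; apply: ler_cvg_to c1 c2 _.
  by apply: nearW => m; exact: h.
have c1 : `|y n - A| @[n --> \oo] --> `|z - A|.
  by apply: cvg_norm; apply: cvgB => //; exact: cvg_cst.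
have c2 : K + C * harmonic n @[n --> \oo] --> K + C * 0.
  by apply: cvgD; [exact: cvg_cst|apply: cvgMr; exact: cvg_harmonic].
rewrite mulr0 addr0 in c2; apply: ler_cvg_to c1 c2 _.
by apply: nearW => m; exact: hy.
Qed.

Lemma expR_le_powR (R : realType) (a q : R) : 0 < a -> exists2 D : R, 0 <= D &
  forall s, 1 <= s -> expR (- a * (s / 2)) <= D * s `^ q.
Proof.
move=> a0.
(* M + 1 >= -q, and the exponential dominates the power s^(M+1). *)
pose M := Num.truncn `|q|.
have qM : - M.+1%:R <= q.
  have := truncnS_gt `|q|; rewrite -/M; have := ler_norm (- q); rewrite normrN.
  by lra.
pose c := (a / 2) ^+ M.+1 / M.+1`!%:R.
have c0 : 0 < c by rewrite divr_gt0 ?exprn_gt0 ?divr_gt0// ltr0n fact_gt0.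
exists c^-1 => [|s s1]; first by rewrite invr_ge0 ltW.
have s0 : 0 < s by exact: lt_le_trans s1.
apply: (@le_trans _ _ (c^-1 * s `^ (- M.+1%:R))); last first.
  by rewrite ler_wpM2l ?invr_ge0 ?(ltW c0)// ler_powR.
rewrite powR_invn ?(ltW s0)// mulNr expRN -invfM lef_pV2 ?posrE ?expR_gt0//;
  last by rewrite mulr_gt0// exprn_gt0.
have h : 0 <= a * (s / 2) by rewrite mulr_ge0// ?(ltW a0)// divr_ge0// ltW.
apply: le_trans (expR_ge1Dxn M h).
have -> : a * (s / 2) = a / 2 * s by ring.
by rewrite exprMn mulrAC ler_wpDl// lexx.
Qed.

Section Pair.
Context (disp : measure_display) (T : measurableType disp) (R : realType).
Variable P : probability T R.
Variables (H1 H2 a b nu1 nu2 c0 p : R) (X1 X2 Y1 Y2 : R -> T -> R).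
Variables (kap kap1 : R -> R).
Hypotheses (H101 : 0 < H1 < 1) (H201 : 0 < H2 < 1) (a0 : 0 < a) (b0 : 0 < b).
Hypotheses (mX1 : forall u, measurable_fun setT (X1 u))
  (mX2 : forall u, measurable_fun setT (X2 u))
  (mY1 : forall u, measurable_fun setT (Y1 u))
  (mY2 : forall u, measurable_fun setT (Y2 u)).
Hypotheses (fX1 : is_fBm P H1 X1) (fX2 : is_fBm P H2 X2).
Hypothesis OU1 : forall t, {ae P, forall w, exists2 l,
  is_RS_integral_ninfty (fun u => expR (- a * (t - u))) (X1 ^~ w) t l &
  Y1 t w = nu1 * l}.
Hypothesis OU2 : forall t, {ae P, forall w, exists2 l,
  is_RS_integral_ninfty (fun u => expR (- b * (t - u))) (X2 ^~ w) t l &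
  Y2 t w = nu2 * l}.
Hypothesis p0 : p < 0.
Hypothesis dkap : forall r : R, 0 < r -> is_derive r 1 kap (kap1 r).
Hypothesis dkap1 : forall r : R, 0 < r -> is_derive r 1 kap1 (- kern c0 p 0 r).
Hypothesis box_cov : forall u u' v v' : R, u <= u' -> u' < v -> v <= v' ->
  box (fun u v => L2dot P (X1 u) (X2 v)) u u' v v' =
  box (fun u v => kap (v - u)) u u' v v'.

(** Weak convergence is applied twice, to one family of Riemann-Stieltjes sums
    with the other sum fixed, and then with the other limit fixed. *)
Lemma innov_dot_le N : exists2 C : R, 0 <= C & forall t s : R, 2 <= s ->
  `|L2dot P (innov a Y1 (t - s / 2) t) (innov b Y2 (t + s / 2) (t + s)) -
    nu1 * nu2 * expansion c0 p a b N 0 s| <=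
  C * (s `^ (p - N.+1%:R) + expR (- a * (s / 2)) + expR (- b * (s / 2))).
Proof.
have [C C0 hC] := kernel_sum_le a0 b0 p0 dkap dkap1 N.
exists (`|nu1 * nu2| * C) => [|t s s2]; first exact: mulr_ge0.
have [C' hC'] := hC t s s2.
have l1 : t - s / 2 < t by lra.
have l2 : t < t + s / 2 by lra.
have l3 : t + s / 2 < t + s by lra.
have [D1 D10 hD1] := innov_sum_L2le nu1 H101 a0 mX1 fX1.
have [D2 D20 hD2] := innov_sum_L2le nu2 H201 b0 mX2 fX2.
have [E1 E10 hE1] := innov_L2le H101 a0 mX1 mY1 fX1 OU1.
have [E2 E20 hE2] := innov_L2le H201 b0 mX2 mY2 fX2 OU2.
pose S1 n := innov_sum a nu1 X1 (t - s / 2) t n.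
pose S2 n := innov_sum b nu2 X2 (t + s / 2) (t + s) n.
have cx n : L2dot P (S1 n) (S2 m) @[m --> \oo] -->
    L2dot P (S1 n) (innov b Y2 (t + s / 2) (t + s)).
  rewrite (L2dotC P (S1 n)); under eq_fun do rewrite L2dotC.
  apply: (@L2dot_lim _ _ _ P S2 _ D2) => //.
  - exact: innov_measurable.
  - by move=> m; exact: hD2.
  - exact: innov_cvg.
  - by have [] := hD1 _ _ n l1.
have cy : L2dot P (S1 n) (innov b Y2 (t + s / 2) (t + s)) @[n --> \oo] -->
    L2dot P (innov a Y1 (t - s / 2) t) (innov b Y2 (t + s / 2) (t + s)).
  apply: (@L2dot_lim _ _ _ P S1 _ D1) => //.
  - exact: innov_measurable.
  - by move=> m; exact: hD1.
  - exact: innov_cvg.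
  - by have [] := hE2 _ _ l3.
apply: (@double_limit_le _ _ _ _ _ _ (`|nu1 * nu2| * C') _ cx cy) => n m.
have hX1 := fBm_L2 mX1 fX1; have hX2 := fBm_L2 mX2 fX2.
rewrite /S1 /S2 /innov_sum L2dotZl ?L2Z ?usum_L2// L2dotZr ?usum_L2// mulrA -mulrBr.
rewrite -[X in _ <= X + _]mulrA -[X in _ <= _ + X]mulrA -mulrDr normrM ler_wpM2l//.
apply: le_trans (hC' n m); rewrite L2dot_usum// le_eqVlt; apply/orP; left; apply/eqP.
congr (`|_ - _|); apply: eq_bigr => i _; apply: eq_bigr => j _; congr (_ * _).
apply: box_cov; [exact: unode_le (ltW l1) _| |exact: unode_le (ltW l3) _].
have := unode_le n.+1 (ltW l1) (ltn_ord i).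
have := unode_le m.+1 (ltW l3) (leq0n j).
by rewrite unode_last unode0; lra.
Qed.

Lemma OU_cov_fin t s : covariance P (Y1 t) (Y2 s) \is a fin_num /\
  fine (covariance P (Y1 t) (Y2 s)) =
  L2dot P (Y1 t) (Y2 s) - L2dot P (Y1 t) (cst 1) * L2dot P (Y2 s) (cst 1).
Proof.
have [C1 C10 hC1] := OU_L2le H101 a0 mX1 mY1 fX1 OU1.
have [C2 C20 hC2] := OU_L2le H201 b0 mX2 mY2 fX2 OU2.
have [h1 _] := hC1 t; have [h2 _] := hC2 s.
have hc : cst 1 \in Lfun P 2%:E by exact: L2_cst.
have e (X : T -> R) : X \* cst 1 = X by apply/funext => w /=; rewrite mulr1.
have E (X : T -> R) : X \in Lfun P 2%:E -> expectation P X = (L2dot P X (cst 1))%:E.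
  by move=> hX; rewrite -L2dotE// e.
have hP : P setT \is a fin_num by exact: fin_num_measure.
have -> : covariance P (Y1 t) (Y2 s) = (L2dot P (Y1 t) (Y2 s) -
    L2dot P (Y1 t) (cst 1) * L2dot P (Y2 s) (cst 1))%:E.
  rewrite covarianceE ?Lfun2_mul_Lfun1 ?(Lfun_subset12 hP)//.
  by rewrite EFinB EFinM -L2dotE// -!E.
by [].
Qed.

(** Replacing [Y1 t] and [Y2 (t + s)] by the contributions of the last s/2 units
    of time costs terms with a factor e^(-a s/2) or e^(-b s/2). *)
Lemma OU_cov_expansion N t : exists D : R, forall s, 2 <= s ->
  `|fine (covariance P (Y1 t) (Y2 (t + s))) - nu1 * nu2 * expansion c0 p a b N 0 s| <=
  D * s `^ (p - N.+1%:R).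
Proof.
have [C C0 hC] := innov_dot_le N.
have [C1 C10 hC1] := OU_L2le H101 a0 mX1 mY1 fX1 OU1.
have [C2 C20 hC2] := OU_L2le H201 b0 mX2 mY2 fX2 OU2.
have [D1 D10 hD1] := expR_le_powR (p - N.+1%:R) a0.
have [D2 D20 hD2] := expR_le_powR (p - N.+1%:R) b0.
pose C12 := C1 * C2.
exists (C * (1 + D1 + D2) + C12 * (3 * D1 + D2)) => s s2.
rewrite (OU_cov_fin _ _).2.
have s1 : 1 <= s by lra.
have l1 : t - s / 2 < t by lra.
have l3 : t + s / 2 < t + s by lra.
have hs := hC t s s2; have e1 := hD1 s s1; have e2 := hD2 s s1.
have m1 := OU_mean_le H101 a0 mX1 mY1 fX1 OU1 C10 hC1 l1.
have m2 : `|L2dot P (Y2 (t + s)) (cst 1)| <= C2.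
  by have := L2dot_le C20 ler01 (hC2 (t + s)) (L2le_cst1 P); rewrite mulr1.
have ta : t - (t - s / 2) = s / 2 by ring.
have tb : t + s - (t + s / 2) = s / 2 by field.
rewrite ta in m1.
have hY1 u := (hC1 u).1; have hY2 u := (hC2 u).1.
have iE : L2dot P (innov a Y1 (t - s / 2) t) (innov b Y2 (t + s / 2) (t + s)) =
   L2dot P (Y1 t) (Y2 (t + s)) - expR (- a * (s / 2)) * L2dot P (Y1 (t - s / 2)) (Y2 (t + s)) -
   expR (- b * (s / 2)) * L2dot P (Y1 t) (Y2 (t + s / 2)) +
   expR (- a * (s / 2)) * expR (- b * (s / 2)) * L2dot P (Y1 (t - s / 2)) (Y2 (t + s / 2)).
  rewrite /innov ta tb; move: (expR (- a * _)) (expR (- b * _)) => x y.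
  have e (Z : R -> T -> R) (r : R) u v :
      (fun w => Z v w - r * Z u w) = Z v \+ (fun w => - r * Z u w).
    by apply/funext => w /=; rewrite mulNr.
  by rewrite !e !(L2dotDl, L2dotDr, L2dotZl, L2dotZr) ?L2D ?L2Z//; ring.
rewrite iE in hs.
have k1 := L2dot_le C10 C20 (hC1 (t - s / 2)) (hC2 (t + s)).
have k2 := L2dot_le C10 C20 (hC1 t) (hC2 (t + s / 2)).
have k3 := L2dot_le C10 C20 (hC1 (t - s / 2)) (hC2 (t + s / 2)).
rewrite -/C12 in k1 k2 k3.
have x0 := expR_ge0 (- a * (s / 2)); have y0 := expR_ge0 (- b * (s / 2)).
have y1 : expR (- b * (s / 2)) <= 1.
  rewrite -[leRHS]expR0 ler_expR mulNr oppr_le0; apply: mulr_ge0; last by lra.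
  exact: ltW b0.
have z0 := powR_ge0 s (p - N.+1%:R).
have C120 : 0 <= C12 by exact: mulr_ge0.
move: hs e1 e2 m1 m2 k1 k2 k3 x0 y0 y1 z0.
move: (expR (- a * _)) (expR (- b * _)) (s `^ _) (nu1 * nu2 * _) => x y z A.
move: (L2dot P (Y1 t) (Y2 (t + s))) (L2dot P (Y1 t) (cst 1))
  (L2dot P (Y2 (t + s)) (cst 1)) => q mm1 mm2.
move: (L2dot _ _ _) (L2dot _ _ _) (L2dot _ _ _) => k3 k2 k1.
move=> hs e1 e2 m1 m2 K1 K2 K3 x0 y0 y1 z0.
have n1 : `|x * k1| <= D1 * z * C12.
  by rewrite normrM ger0_norm//; apply: ler_pM.
have n2 : `|y * k2| <= D2 * z * C12.
  by rewrite normrM ger0_norm//; apply: ler_pM.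
have n3 : `|x * y * k3| <= D1 * z * C12.
  rewrite -mulrA normrM ger0_norm//; apply: ler_pM => //.
  by rewrite normrM ger0_norm// (le_trans _ K3)// ler_piMl.
have n4 : `|mm1 * mm2| <= D1 * z * C12.
  rewrite normrM /C12 mulrA; apply: ler_pM => //.
  by apply: le_trans m1 _; rewrite ler_wpM2r.
have n5 : C * (z + x + y) <= C * (z + D1 * z + D2 * z).
  by rewrite ler_wpM2l// lerD// lerD.
move: hs n1 n2 n3 n4 n5; rewrite !ler_norml => /andP[a1 a2] /andP[b1 b2] /andP[c1 c2].
move=> /andP[d1 d2] /andP[f1 f2] n5.
have -> : (C * (1 + D1 + D2) + C12 * (3 * D1 + D2)) * z =
  C * (z + D1 * z + D2 * z) + 3 * (D1 * z * C12) + D2 * z * C12 by ring.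
move: (D1 * z * C12) (D2 * z * C12) (C * (z + D1 * z + D2 * z)) (C * (z + x + y))
  a1 a2 b1 b2 c1 c2 d1 d2 f1 f2 n5.
move: (x * k1) (y * k2) (x * y * k3) (mm1 * mm2).
by move=> r1 r2 r3 r4 u1 u2 u3 u4 a1 a2 b1 b2 c1 c2 d1 d2 f1 f2 n5; apply/andP; split; lra.
Qed.
End Pair.

(** * The cross-covariance kernel of the fractional Brownian motion *)

Section CovarianceKernel.
Context (R : realType).
Variables (h rho eta : R).

(** The part of the covariance of B^i_u and B^j_v that is not a sum of a function
    of u and a function of v, as a function of r = v - u > 0. *)
Definition cov_kernel (r : R) : R :=
  if h == 1 then - 2^-1 * (rho * r + eta * (r * ln r))
  else - 2^-1 * (rho - eta) * r `^ h.

Definition cov_kernel1 (r : R) : R :=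
  if h == 1 then - 2^-1 * (rho + eta * (ln r + 1))
  else - 2^-1 * (rho - eta) * (h * r `^ (h - 1)).

(** The mixed derivative of [cov_kernel] (v - u) is minus its second derivative,
    which has the form [cov_scale] r^(h-2) for h = 1 as well: the logarithm
    leaves r^(-1). *)
Definition cov_scale : R :=
  if h == 1 then 2^-1 * eta else 2^-1 * (rho - eta) * h * (h - 1).

Lemma cov_kernel_derive (r : R) : 0 < r -> is_derive r 1 cov_kernel (cov_kernel1 r).
Proof.
move=> r0; rewrite /cov_kernel1.
have [h1|h1] := eqVneq h 1.
  have e : cov_kernel = (fun r => - 2^-1 * (rho * id r + eta * (id r * ln r))).
    by apply/funext => z; rewrite /cov_kernel h1 eqxx.
  have d1 := deriveM_fun (is_derive_id r 1) (is_derive1_ln r0).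
  have d := deriveZ_fun (- 2^-1) (deriveD_fun (deriveZ_fun rho (is_derive_id r 1))
    (deriveZ_fun eta d1)).
  rewrite e; apply: (is_derive_eq d).
  by rewrite /= mulfV ?gt_eqF//; ring.
have e : cov_kernel = (fun r => - 2^-1 * (rho - eta) * r `^ h).
  by apply/funext => z; rewrite /cov_kernel (negbTE h1).
rewrite e; exact: (deriveZ_fun _ (is_derive1_powR h r0)).
Qed.

Lemma cov_kernel1_derive (r : R) : 0 < r ->
  is_derive r 1 cov_kernel1 (- kern cov_scale (h - 2) 0 r).
Proof.
move=> r0; rewrite /kern /dpow big_geq// mulr1 subr0 /cov_scale.
have [h1|h1] := eqVneq h 1.
  have e : cov_kernel1 = (fun r => - 2^-1 * (rho + eta * (ln r + 1))).
    by apply/funext => z; rewrite /cov_kernel1 h1 eqxx.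
  have d := deriveZ_fun (- 2^-1) (deriveD_fun (derive_cst_fun rho r)
    (deriveZ_fun eta (deriveD_fun (is_derive1_ln r0) (derive_cst_fun 1 r)))).
  rewrite e; apply: (is_derive_eq d).
  have -> : h - 2 = -1 :> R by rewrite h1; ring.
  by rewrite powR_inv1 ?ltW//; ring.
have e : cov_kernel1 = (fun r => - 2^-1 * (rho - eta) * (h * r `^ (h - 1))).
  by apply/funext => z; rewrite /cov_kernel1 (negbTE h1).
have d := deriveZ_fun (- 2^-1 * (rho - eta)) (deriveZ_fun h (is_derive1_powR (h - 1) r0)).
rewrite e; apply: (is_derive_eq d).
have -> : h - 1 - 1 = h - 2 :> R by ring.
by ring.
Qed.

(** Functions of one of the two times drop out of mixed differences. *)
Lemma box_mfBm_cov (u u' v v' : R) : u <= u' -> u' < v -> v <= v' ->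
  box (mfBm_cov h rho eta) u u' v v' = box (fun u v => cov_kernel (v - u)) u u' v v'.
Proof.
move=> uu uv vv; rewrite /box /mfBm_cov /cov_kernel.
have n x y : x < y -> `|y - x| = y - x by move=> xy; rewrite ger0_norm// subr_ge0 ltW.
have s x y : x < y -> sign (y - x) = 1 by move=> xy; rewrite /sign subr_ge0 ltW.
have l1 : u < v by lra.
have l2 : u < v' by lra.
have l3 : u' < v' by lra.
rewrite !n// !s//; case: ifP => _; ring.
Qed.
End CovarianceKernel.

(** * The asymptotic expansion *)

Lemma bigO_pinfty (R : realType) (f g : R -> R) (D : R) :
  (forall s, 2 <= s -> `|f s| <= D * `|g s|) -> f =O_+oo g.
Proof.
move=> h; apply/eqO_exP; exists (`|D| + 1); first by rewrite ltr_wpDl.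
near=> s; apply: (@le_trans _ _ (D * `|g s|)).
  by apply: h; near: s; apply: nbhs_pinfty_ge; rewrite num_real.
by rewrite ler_wpM2r// (le_trans (ler_norm D))// lerDl.
Unshelve. all: by end_near. Qed.

Theorem theorem2p5 (disp : measure_display) (T : measurableType disp)
  (R : realType) (P : probability T R) (d : nat)
  (H alpha nu : 'I_d -> R) (rho eta : 'I_d -> 'I_d -> R)
  (B Y : 'I_d -> R -> {RV P >-> R})
  (hH : forall k : 'I_d, 0 < H k < 1 /\ H k != 2^-1)
  (halpha : forall k : 'I_d, 0 < alpha k)
  (hnu : forall k : 'I_d, 0 < nu k)
  (hB : is_mfBm H B)
  (hpar : mfBm_params H B rho eta)
  (hY : is_mfOU alpha nu B Y)
  (i j : 'I_d) (hij : i != j) (N : nat) (t : R) :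
  (forall s : R, covariance P (Y i t) (Y j (t + s)) \is a fin_num) /\
  (H i + H j != 1 ->
    (fun s : R => fine (covariance P (Y i t) (Y j (t + s))) -
      nu i * nu j * (rho i j + eta j i) / (2 * (alpha i + alpha j)) *
      \sum_(0 <= n < N.+1)
        ((-1) ^+ n / alpha j ^+ n.+1 + 1 / alpha i ^+ n.+1) *
        (\prod_(0 <= k < n.+2) (H i + H j - k%:R)) *
        s `^ (H i + H j - 2 - n%:R))
    =O_+oo (fun s : R => s `^ (H i + H j - N%:R - 3))) /\
  (H i + H j = 1 ->
    (fun s : R => fine (covariance P (Y i t) (Y j (t + s))) -
      (- (nu i * nu j * eta j i / (2 * alpha i * alpha j)) * (1 / s) -
       nu i * nu j * eta j i / (2 * (alpha i + alpha j)) *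
       \sum_(1 <= n < N.+1)
         ((-1) ^+ n / alpha j ^+ n.+1 + 1 / alpha i ^+ n.+1) *
         (\prod_(0 <= k < n) (- k%:R - 1)) *
         s `^ (- 1 - n%:R)))
    =O_+oo (fun s : R => s `^ (- N%:R - 2))).
Proof.
have H01 k : 0 < H k < 1 := (hH k).1.
have mB k u : measurable_fun setT (B k u) by exact: measurable_funPT.
have mY k u : measurable_fun setT (Y k u) by exact: measurable_funPT.
have fB k := mfBm_fBm hB k.
have B0 k u : expectation P (B k u) = 0%E := mfBm_centered hB (k, u).
have BL2 k u := fBm_L2 (mB k) (fB k) u.
have dotB u v : L2dot P (B i u) (B j v) = mfBm_cov (H i + H j) (rho i j) (eta i j) u v.
  apply: EFin_inj; rewrite -L2dotE// -covariance_centered//.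
  by have -> := mfBm_covE hpar hij u v.
have hbox (u u' v v' : R) : u <= u' -> u' < v -> v <= v' ->
    box (fun u v => L2dot P (B i u) (B j v)) u u' v v' =
    box (fun u v => cov_kernel (H i + H j) (rho i j) (eta i j) (v - u)) u u' v v'.
  by move=> h1 h2 h3; rewrite -box_mfBm_cov// /box !dotB.
have p0 : H i + H j - 2 < 0.
  by have /andP[_ h1] := H01 i; have /andP[_ h2] := H01 j; lra.
have eta_ji : eta i j = - eta j i := eta_antisym hpar hij.
have a0 := halpha i; have b0 := halpha j.
have a1 : alpha i != 0 by rewrite gt_eqF.
have b1 : alpha j != 0 by rewrite gt_eqF.
have ab : alpha i + alpha j != 0 by rewrite gt_eqF// addr_gt0.
split.
  move=> s; have [] := OU_cov_fin (H01 i) (H01 j) a0 b0 (mB i) (mB j) (mY i) (mY j)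
    (fB i) (fB j) (hY i) (hY j) t (t + s).
  by [].
have [D hD] := OU_cov_expansion (H01 i) (H01 j) a0 b0 (mB i) (mB j) (mY i) (mY j)
    (fB i) (fB j) (hY i) (hY j) p0
    (@cov_kernel_derive _ (H i + H j) (rho i j) (eta i j))
    (@cov_kernel1_derive _ (H i + H j) (rho i j) (eta i j)) hbox N t.
split => h1; apply: (@bigO_pinfty _ _ _ D) => s s2;
  rewrite (ger0_norm (powR_ge0 _ _)); have := hD s s2.
- have -> : H i + H j - 2 - N.+1%:R = H i + H j - N%:R - 3 by rewrite -natr1; ring.
  congr (`|_ - _| <= _); rewrite /expansion !mulr_sumr; apply: eq_bigr => n _.
  rewrite /ecoef /kern /dpow /cov_scale (negbTE h1) addn0 eta_ji.
  (* The factors h (h - 1) come from the second derivative of r^h. *)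
  have -> : \prod_(0 <= k < n.+2) (H i + H j - k%:R) =
      (H i + H j) * ((H i + H j - 1) * \prod_(0 <= k < n) (H i + H j - 2 - k%:R)).
    rewrite !big_nat_recl// subr0; congr (_ * (_ * _)).
    by apply: eq_bigr => k _; rewrite -!natr1; ring.
  move: (\prod_(_ <= _ < _) _) (s `^ _) => q z.
  field; by rewrite ab ?expf_neq0 ?a1 ?b1.
- have -> : H i + H j - 2 - N.+1%:R = - N%:R - 2 by rewrite h1 -natr1; ring.
  congr (`|_ - _| <= _); rewrite /expansion big_nat_recl//.
  rewrite [in RHS]big_add1/= mulrDr !mulr_sumr.
  rewrite /ecoef /kern /dpow /cov_scale h1 eqxx.
  have s0 : 0 < s by lra.
  congr (_ + _).
    (* The coefficient of n = 0 is (1/a + 1/b)/(a + b) = 1/(a b). *)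
    rewrite addn0 big_geq// (_ : 1 - 2 - 0%:R = -1 :> R); last by ring.
    rewrite powR_inv1 ?(ltW s0)// eta_ji expr0 !expr1; field.
    by rewrite ab a1 b1 gt_eqF.
  rewrite -sumrN; apply: eq_bigr => n _.
  rewrite addn0 eta_ji.
  have -> : \prod_(0 <= k < n.+1) (- k%:R - 1) =
      \prod_(0 <= k < n.+1) (1 - 2 - k%:R) :> R by apply: eq_bigr => k _; ring.
  rewrite (_ : 1 - 2 - n.+1%:R = - 1 - n.+1%:R :> R); last by ring.
  move: (\prod_(_ <= _ < _) _) (s `^ _) => q z.
  field; by rewrite ab ?expf_neq0 ?a1 ?b1.
Qed.
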